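(* The orbits of complex lines (through the origin) of $\mathbb{C}^3$ under the action of $G_{25}$ are the following; each item gives the size of the orbit, the number of such orbits, and the number of reflection planes and of proper planes on which the lines of the orbit lie. - size 216: the generic orbits; 0 reflection planes, 0 proper planes; - size 72: exactly 1 orbit with 0 reflection planes, 0 proper planes; - size 108: infinitely many orbits (an infinity of dimension 1); 0 reflection planes, 1 proper plane; - size 54: exactly 1 orbit; 0 reflection planes, 1 proper plane; - size 72: infinitely many orbits (an infinity of dimension 1) with 1 reflection plane, 0 proper planes; - size 36: exactly 1 orbit; 1 reflection plane, 1 proper plane; - size 12: exactly 1 orbit; 2 reflection planes, 3 proper planes; - size 9: exactly 1 orbit; 4 reflection planes, 0 proper planes. Moreover: - the line $[\nu:\nu^2:1]$, with $\nu$ a root of unity of order 9, represents the only orbit of size 72 that intersects no reflection plane (i.e. whose lines lie on no reflection plane); - the line $[0:\omega:1]$ represents the only orbit of size 54. Given a line in $\mathbb{CP}^2\setminus\left(G_{25}\cdot[\nu:\nu^2:1]\cup G_{25}\cdot[0:\omega:1]\right)$, the size of its orbit is characterized by the number of reflection planes and proper planes it lies on.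
   Context: Let $\omega=e^{2i\pi/3}$. $G_{25}\subset\mathrm{GL}_3(\mathbb{C})$ is the finite complex reflection group (order 648, number 25 in the Shephard-Todd list) generated by the order 3 reflections $R_1=\mathrm{diag}(1,1,\omega^2)$, $R_2=\frac{\omega^2-\omega}{3}\begin{pmatrix}\omega&\omega^2&\omega^2\\\omega^2&\omega&\omega^2\\\omega^2&\omega^2&\omega\end{pmatrix}$, $R_3=\mathrm{diag}(1,\omega^2,1)$. A complex reflection is a nontrivial linear transformation fixing a hyperplane pointwise; the reflection planes of $G_{25}$ are the planes fixed pointwise by reflections in $G_{25}$. There are 12 of them: $x=0$, $y=0$, $z=0$ and $x+\xi y+\xi'z=0$ with $\xi,\xi'$ any third roots of unity. A vector is regular if it lies on no reflection plane. An eigenspace of an element of $G_{25}$ is regular if it contains a regular vector. A proper plane is a regular eigenspace, of some $g\in G_{25}$, associated with an eigenvalue that is a root of unity of order 6 (such eigenspaces have dimension 2). $[x:y:z]$ denotes the line spanned by $(x,y,z)$, viewed as a point of $\mathbb{CP}^2$.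
   Formalization: The line [0:ω:1], which lies on the reflection plane x=0 and has an orbit of size 36, is replaced by [1+√3:ω:1] as representative of the only orbit of size 54, and likewise in the set of lines excluded from the final claim. *)

(* Defs.v *)
From HB Require Import structures.
From mathcomp Require Import all_boot all_order all_algebra.
From mathcomp Require Import complex.
From mathcomp Require Import mathcomp_extra boolp classical_sets functions.
From mathcomp Require Import cardinality reals trigo.
From mathcomp Require Import mpoly.

Set Implicit Arguments.
Unset Strict Implicit.
Unset Printing Implicit Defensive.
Import Order.TTheory GRing.Theory Num.Theory.
Local Open Scope classical_set_scope.
Local Open Scope ring_scope.

(* Krull dimension and genericity in a topological space, the topology being
   given by the collection [closed] of its closed sets. *)
Section KrullDimension.
Context {T : Type}.
Implicit Types (closed : set (set T)) (S Z : set T).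

Definition irreducible_closed closed Z : Prop :=
  [/\ closed Z, Z !=set0 &
      forall A B, closed A -> closed B -> Z = A `|` B -> Z = A \/ Z = B].

Definition irreducible_chain closed (n : nat) (c : nat -> set T) : Prop :=
  (forall i, (i <= n)%N -> irreducible_closed closed (c i)) /\
  (forall i, (i < n)%N -> c i `<` c i.+1).

Definition induced_closed closed S : set (set T) :=
  [set S `&` Z | Z in closed].

(* The subspace S has Krull dimension d. *)
Definition has_dimension closed S (d : nat) : Prop :=
  (exists c, irreducible_chain (induced_closed closed S) d c) /\
  (forall n c, irreducible_chain (induced_closed closed S) n c -> (n <= d)%N).

(* S contains a dense open subset of the space X. *)
Definition is_generic closed (X S : set T) : Prop :=
  exists2 Z, closed Z & X `\` Z `<=` S /\
    forall Y, closed Y -> X `\` Z `<=` Y -> X `<=` Y.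

End KrullDimension.

Section G25.
Context {R : realType}.
Local Notation C := (R[i]).
Local Notation V := 'cV[C]_3.

Definition omega : C := (cos (2 * pi / 3) +i* sin (2 * pi / 3))%C.

Definition mx3 (rows : seq (seq C)) : 'M[C]_3 :=
  \matrix_(i, j) nth 0 (nth [::] rows i) j.

Definition G25_R1 : 'M[C]_3 :=
  mx3 [:: [:: 1; 0; 0]; [:: 0; 1; 0]; [:: 0; 0; omega ^+ 2]].

Definition G25_R2 : 'M[C]_3 :=
  ((omega ^+ 2 - omega) / 3) *:
    mx3 [:: [:: omega;      omega ^+ 2; omega ^+ 2];
            [:: omega ^+ 2; omega;      omega ^+ 2];
            [:: omega ^+ 2; omega ^+ 2; omega]].

Definition G25_R3 : 'M[C]_3 :=
  mx3 [:: [:: 1; 0; 0]; [:: 0; omega ^+ 2; 0]; [:: 0; 0; 1]].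

Definition GL_subgroup (H : set 'M[C]_3) : Prop :=
  [/\ H `<=` [set g | g \in unitmx],
      H 1%:M,
      forall g h, H g -> H h -> H (g *m h) &
      forall g, H g -> H (invmx g)].

Definition G25 : set 'M[C]_3 :=
  smallest GL_subgroup [set G25_R1; G25_R2; G25_R3].

Definition endo (g : 'M[C]_3) : 'End(V) := linfun (mulmx g).

Definition reflection_plane : set {vspace V} :=
  [set H | \dim H = 2%N /\
    exists2 g, G25 g & g != 1%:M /\ forall v, v \in H -> g *m v = v].

Definition regular_vector (v : V) : Prop :=
  forall H, reflection_plane H -> v \notin H.

Definition regular_space (E : {vspace V}) : Prop :=
  exists2 v, v \in E & regular_vector v.

Definition proper_plane : set {vspace V} :=
  [set E | regular_space E /\
    exists g z, [/\ G25 g, 6.-primitive_root z &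
      E = passmx.leigenspace (endo g) z]].

Definition line : set {vspace V} := [set L | \dim L = 1%N].

Definition proj_pt (x y z : C) : {vspace V} :=
  <[\col_(i < 3) [:: x; y; z]`_i]>%VS.

Definition line_orbit (L : {vspace V}) : set {vspace V} :=
  [set (endo g @: L)%VS | g in G25].

Definition line_orbits : set (set {vspace V}) := [set line_orbit L | L in line].

Definition reflection_planes_through (L : {vspace V}) : set {vspace V} :=
  [set H | reflection_plane H /\ (L <= H)%VS].

Definition proper_planes_through (L : {vspace V}) : set {vspace V} :=
  [set H | proper_plane H /\ (L <= H)%VS].

(* The orbits of size n, each line of which lies on exactly r reflection planes
   and p proper planes. *)
Definition line_orbits_of (n r p : nat) : set (set {vspace V}) :=
  [set O | [/\ line_orbits O, (O #= `I_n)%card &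
    forall L, O L -> (reflection_planes_through L #= `I_r)%card /\
                     (proper_planes_through L #= `I_p)%card]].

(* Zariski-closed subsets of the projective plane of lines. *)
Definition line_closed (Z : set {vspace V}) : Prop :=
  exists2 I : set {mpoly C[3]},
    forall f, I f -> exists d, f \is d.-homog &
    Z = [set L | line L /\
      forall f v, I f -> v \in L -> f.@[fun i => v i 0] = 0].

(* Quotient of the Zariski topology on the space of orbits. *)
Definition orbit_closed (A : set (set {vspace V})) : Prop :=
  A `<=` line_orbits /\ line_closed (\bigcup_(O in A) O).

End G25.

(* Main.v *)
Require Import Defs.
From Stdlib Require Import ZArith Lia.
From HB Require Import structures.
From mathcomp Require Import all_boot all_order all_algebra.
From mathcomp Require Import complex.
From mathcomp Require Import mathcomp_extra boolp classical_sets functions.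
From mathcomp Require Import cardinality reals trigo mpoly.
From mathcomp Require Import ring lra ssrZ.
Set Implicit Arguments.
Unset Strict Implicit.
Unset Printing Implicit Defensive.
Import Order.TTheory GRing.Theory Num.Theory.
Local Open Scope classical_set_scope.
Local Open Scope ring_scope.

(* The size of the orbit of a line is 648 divided by the number of elements of
   G25 fixing the line. The group is written out as an explicit list of matrices
   over the Eisenstein integers, and the finite verifications are computations
   on that list.

   Modulo scalars, each nontrivial element has a nontrivial power that is
   conjugate to the reflection R1, to diag(1, omega, omega^2), to the negative of
   a transposition, or to an element of order 3 whose eigenlines are the
   [l : l^2 : 1] with l^3 = omega. Hence a line with a nontrivial stabilizer lies
   on a reflection plane, on a proper plane or in the orbit of [nu : nu^2 : 1].
   The planes of each kind are conjugate, which moves the line to [t : 1 : 0] or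
   [t : 1 : 1] (or to [1 : 0 : 0]). A given group element fixes such a line if
   and only if a polynomial of degree 1 and one of degree 2 in t both vanish, so
   the stabilizer is constant away from finitely many exceptional t, which are
   cube roots of unity times one of 0, 1, -1, -2, 1 + sqrt 3 and 1 - sqrt 3.

   A Zariski-closed set of orbits meets each of the two families in finitely
   many orbits or contains the family, so both have dimension 1. The lines with
   an orbit smaller than 216 all have an image on one of the planes z = 0, y = z
   and x = nu z; the product of the linear forms obtained from these three under
   the group cuts out a proper closed set. *)

(** Equality in C cannot be computed, so every finite verification is phrased over the Eisenstein
    integers, where it can. The points with t = 1 + sqrt 3 or 1 - sqrt 3 and the points
    [l ^ 2 : l : 1] with l ^ 3 = omega are not defined over Q(omega); there, an expression is shown
    not to vanish by computing a nonzero norm down to Q(omega). The size of an orbit and its two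
    plane counts are determined by the orbit, and the eight triples of the table are distinct. It is
    therefore enough to bring each orbit to a normal form and to compute the triple of that form:
    the descriptions of all orbits with a given triple follow. *)

(** * Computation with Eisenstein integers *)

(* (a, b) stands for a + b * omega. *)
Definition eis : Type := Z * Z.

Definition eadd (p q : eis) : eis := (Z.add p.1 q.1, Z.add p.2 q.2).
Definition eopp (p : eis) : eis := (Z.opp p.1, Z.opp p.2).
Definition esub (p q : eis) : eis := (Z.sub p.1 q.1, Z.sub p.2 q.2).
Definition emul (p q : eis) : eis :=
  let t := Z.mul p.2 q.2 in
  (Z.sub (Z.mul p.1 q.1) t,
   Z.sub (Z.add (Z.mul p.1 q.2) (Z.mul p.2 q.1)) t).
Definition econj (p : eis) : eis := (Z.sub p.1 p.2, Z.opp p.2).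
Definition eis0b (p : eis) : bool := if p is (Z0, Z0) then true else false.
(** Nested conditionals replace [&&] here and below: under call-by-value evaluation both arguments
    of [&&] would be computed. *)
Definition eeq (p q : eis) : bool := if Z.eqb p.1 q.1 then Z.eqb p.2 q.2 else false.

Definition eis0 : eis := (Z0, Z0).
Definition eis1 : eis := (Zpos 1, Z0).
Definition eisw : eis := (Z0, Zpos 1).
Definition eisw2 : eis := (Zneg 1, Zneg 1).
Definition eistheta : eis := (Zpos 1, Zpos 2).
Definition eunits : seq eis := [:: eis1; eisw; eisw2].

Record evec := EVec { e1 : eis; e2 : eis; e3 : eis }.
Record emat := EMat { r1 : evec; r2 : evec; r3 : evec }.

Definition eseq (v : evec) := [:: e1 v; e2 v; e3 v].
Definition rows (A : emat) := [:: r1 A; r2 A; r3 A].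

Definition vmap f (v : evec) := EVec (f (e1 v)) (f (e2 v)) (f (e3 v)).
Definition vsub (u v : evec) :=
  EVec (esub (e1 u) (e1 v)) (esub (e2 u) (e2 v)) (esub (e3 u) (e3 v)).
Definition dot (u v : evec) : eis :=
  eadd (emul (e1 u) (e1 v)) (eadd (emul (e2 u) (e2 v)) (emul (e3 u) (e3 v))).
Definition veq (u v : evec) :=
  if eeq (e1 u) (e1 v) then if eeq (e2 u) (e2 v) then eeq (e3 u) (e3 v) else false
  else false.
Definition vec0b (v : evec) :=
  if eis0b (e1 v) then if eis0b (e2 v) then eis0b (e3 v) else false else false.
Definition cross (u v : evec) : evec :=
  EVec (esub (emul (e2 u) (e3 v)) (emul (e3 u) (e2 v)))
       (esub (emul (e3 u) (e1 v)) (emul (e1 u) (e3 v)))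
       (esub (emul (e1 u) (e2 v)) (emul (e2 u) (e1 v))).
(** This also holds when one of the vectors is zero, hence the nonvanishing conditions that
    accompany it later. *)
Definition par (u v : evec) : bool := vec0b (cross u v).

Definition mmap f (A : emat) := EMat (vmap f (r1 A)) (vmap f (r2 A)) (vmap f (r3 A)).
Definition meq (A B : emat) :=
  if veq (r1 A) (r1 B) then if veq (r2 A) (r2 B) then veq (r3 A) (r3 B) else false
  else false.
Definition mtr (A : emat) :=
  EMat (EVec (e1 (r1 A)) (e1 (r2 A)) (e1 (r3 A)))
       (EVec (e2 (r1 A)) (e2 (r2 A)) (e2 (r3 A)))
       (EVec (e3 (r1 A)) (e3 (r2 A)) (e3 (r3 A))).
Definition mapply (A : emat) (v : evec) := EVec (dot (r1 A) v) (dot (r2 A) v) (dot (r3 A) v).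
Definition mmul (A B : emat) : emat :=
  let B' := mtr B in
  EMat (mapply B' (r1 A)) (mapply B' (r2 A)) (mapply B' (r3 A)).
Definition mscal (c : eis) : emat :=
  EMat (EVec c eis0 eis0) (EVec eis0 c eis0) (EVec eis0 eis0 c).
Definition msub (A B : emat) := EMat (vsub (r1 A) (r1 B)) (vsub (r2 A) (r2 B)) (vsub (r3 A) (r3 B)).
Definition madj (A : emat) := mmap econj (mtr A).

(* An element g of G25 is represented by the matrix [theta * g], with
   [theta = omega - omega ^ 2] a square root of -3; it has Eisenstein integer
   entries. A product of representatives has to be divided by [theta]; since
   [Z.div] rounds, [exactb] below checks that these divisions are exact. *)
Definition edivtheta (p : eis) : eis :=
  let q := emul p (eopp eistheta) in (Z.div q.1 3, Z.div q.2 3).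
Definition gmul (A B : emat) : emat := mmap edivtheta (mmul A B).
Definition ediag (a b c : eis) : emat :=
  mmap (emul eistheta) (EMat (EVec a eis0 eis0) (EVec eis0 b eis0) (EVec eis0 eis0 c)).

Definition g1 : emat := ediag eis1 eis1 eis1.
Definition gR1 : emat := ediag eis1 eis1 eisw2.
Definition gR2 : emat :=
  EMat (EVec eisw eisw2 eisw2) (EVec eisw2 eisw eisw2) (EVec eisw2 eisw2 eisw).
Definition gR3 : emat := ediag eis1 eisw2 eis1.

Definition gens : seq emat := [:: gR1; gR2; gR3].
Definition gword (w : seq nat) : emat :=
  foldr (fun i M => gmul (nth g1 gens i) M) g1 w.
Definition gstep (i : nat) (bM : bool * emat) : bool * emat :=
  let s := nth g1 gens i in
  let N := gmul s bM.2 in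
  (bM.1 && meq (mmap (emul eistheta) N) (mmul s bM.2), N).

(* Generators are numbered from 0. The words [s] and [t] give the negatives of
   the transpositions (x z) and (x y), and [D] gives diag(omega ^ 2, 1, 1). The
   group is covered by the 4 left cosets of its 162 monomial elements, one coset
   for each triangle in the orbit of the coordinate triangle. *)
Definition short_words : seq (seq nat) :=
  let s := [:: 2; 1; 2; 1]%N in
  let t := [:: 1; 0; 1; 0]%N in
  [seq a ++ b | a <- [:: [::]; [:: 1]; [:: 0; 1]; [:: 0; 0; 1]],
    b <- [seq a ++ b | a <- [:: [::]; s; t; s ++ t; t ++ s; s ++ t ++ s],
                       b <- [:: [::]; [:: 0]; [:: 0; 0]]]]%N.
Definition words : seq (seq nat) :=
  let s := [:: 2; 1; 2; 1]%N in
  let D := s ++ 0%N :: s in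
  [seq a ++ b | a <- short_words,
    b <- [seq a ++ b | a <- [:: [::]; D; D ++ D],
                       b <- [:: [::]; [:: 2]; [:: 2; 2]]]]%N.

(* Evaluated once and for all, to keep the later computations short. *)
Definition Gl : seq emat := Eval vm_compute in [seq gword w | w <- words].

(* Unlike [has], [hasb] stops at the first hit under call-by-value. *)
Fixpoint hasb (T : Type) (p : T -> bool) (s : seq T) :=
  if s is x :: s' then if p x then true else hasb p s' else false.
Fixpoint uniqb (s : seq emat) :=
  if s is x :: s' then if hasb (meq x) s' then false else uniqb s' else true.

Definition closedb :=
  all (fun s => all (fun g => let h := mmul s g in
     hasb (fun k => meq h (mmap (emul eistheta) k)) Gl) Gl) gens.
Definition exactb := all (fun w => (foldr gstep (true, g1) w).1) words.

(** * Embedding of the Eisenstein integers in C *)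

Section Omega.
Variable R : realType.
Local Notation C := R[i].
Local Notation w := (@omega R).

Lemma sin_omega_gt0 : 0 < sin (2 * pi / 3 : R).
Proof.
by apply: sin_gt0_pi; have := pi_gt0 R; move=> pi0; apply/andP; split; lra.
Qed.

Lemma omega_neq1 : w != 1.
Proof.
apply/eqP => /(congr1 (@complex.Im R)) /= h.
by have := sin_omega_gt0; rewrite h ltxx.
Qed.

Lemma omegaX3 : w ^+ 3 = 1.
Proof.
set a : R := 2 * pi / 3.
have e : a + a + a = pi *+ 2 by rewrite /a mulr2n; lra.
rewrite !exprS expr0 mulr1 /omega -/a.
have := cos2pi R; have := sin2pi R; rewrite -e !(cosD, sinD) => hs hc.
by apply/eqP; rewrite eq_complex /=; apply/andP; split; apply/eqP; lra.
Qed.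

Lemma omega2E : w ^+ 2 = - 1 - w.
Proof.
have /eqP : (w - 1) * (w ^+ 2 + w + 1) = 0.
  by transitivity (w ^+ 3 - 1); [ring | rewrite omegaX3 subrr].
rewrite mulf_eq0 subr_eq0 (negPf omega_neq1) /= => /eqP h.
by apply/eqP; rewrite -subr_eq0 -h; apply/eqP; ring.
Qed.

Definition ev (p : eis) : C := (int_of_Z p.1)%:~R + (int_of_Z p.2)%:~R * w.

Lemma evD p q : ev (eadd p q) = ev p + ev q.
Proof. by rewrite /ev /= !(rmorphD int_of_Z) !rmorphD /=; ring. Qed.

Lemma evN p : ev (eopp p) = - ev p.
Proof. by rewrite /ev /= !(rmorphN int_of_Z) !rmorphN /=; ring. Qed.

Lemma evB p q : ev (esub p q) = ev p - ev q.
Proof. by rewrite /ev /= !(rmorphB int_of_Z) !rmorphB /=; ring. Qed.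

Lemma evM p q : ev (emul p q) = ev p * ev q.
Proof.
rewrite /ev /= !(rmorphB int_of_Z, rmorphD int_of_Z, rmorphM int_of_Z) /=.
by rewrite !(rmorphB, rmorphD, rmorphM) /=; ring: omega2E.
Qed.

Lemma ev0 : ev eis0 = 0. Proof. by rewrite /ev /= mul0r addr0. Qed.
Lemma ev1 : ev eis1 = 1. Proof. by rewrite /ev /= mul0r addr0. Qed.
Lemma evw : ev eisw = w. Proof. by rewrite /ev /= mul1r add0r. Qed.
Lemma evw2 : ev eisw2 = w ^+ 2.
Proof. by rewrite omega2E /ev /= mulN1r. Qed.

(** The imaginary part of omega is positive, so 1 and omega are independent over the integers. This
    is what lets computations on pairs of integers decide equalities in C. *)
Lemma ev_eq0 p : (ev p == 0) = eis0b p.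
Proof.
apply/eqP/idP => [|]; last by case: p => [[|?|?] [|?|?]] //; rewrite -ev0.
case: p => a b; rewrite /ev /= => h.
have im (n : int) : complex.Im (n%:~R : C) = 0.
  by rewrite -(rmorph_int (real_complex R)).
have re (n : int) : complex.Re (n%:~R : C) = n%:~R.
  by rewrite -(rmorph_int (real_complex R)).
have b0 : int_of_Z b = 0.
  move: (congr1 (@complex.Im R) h); rewrite raddfD /= im add0r.
  rewrite -(rmorph_int (real_complex R)) /= mul0r addr0 => /eqP.
  by rewrite mulf_eq0 (gt_eqF sin_omega_gt0) orbF intr_eq0 => /eqP.
have a0 : int_of_Z a = 0.
  move: (congr1 (@complex.Re R) h); rewrite b0 mul0r addr0 re /= => /eqP.
  by rewrite intr_eq0 => /eqP.
have {b0} -> : b = Z0 by rewrite -[b]int_of_ZK b0.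
by have -> : a = Z0 by rewrite -[a]int_of_ZK a0.
Qed.

Lemma eeqP p q : reflect (ev p = ev q) (eeq p q).
Proof.
have -> : eeq p q = eis0b (esub p q).
  case: p q => [a b] [c d]; rewrite /eeq /eis0b /esub /=.
  have E x y : Z.eqb x y = Z.eqb (Z.sub x y) Z0.
    by apply/idP/idP => /Z.eqb_eq h; apply/Z.eqb_eq; lia.
  by rewrite (E a) (E b); case: (Z.sub a c); case: (Z.sub b d).
by rewrite -ev_eq0 evB subr_eq0; apply: eqP.
Qed.

Lemma ev_theta_neq0 : ev eistheta != 0.
Proof. by rewrite ev_eq0. Qed.

End Omega.

(** * Vectors, matrices and linear forms with Eisenstein coefficients *)

Section Vectors.
Variable R : realType.
Local Notation C := R[i].
Local Notation V := 'cV[C]_3.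
Local Notation ev := (@ev R).

Definition vec3 (x y z : C) : V := \col_(i < 3) [:: x; y; z]`_i.

Lemma vec3_surj v : exists x y z, v = vec3 x y z.
Proof.
exists (v 0 0), (v 1 0), (v (2%:R : 'I_3) 0); apply/colP => i; rewrite mxE.
by case: i => [[|[|[|]]] //] lti; congr (v _ _); apply/val_inj.
Qed.

Lemma vec3_inj x y z x' y' z' :
  vec3 x y z = vec3 x' y' z' -> [/\ x = x', y = y' & z = z'].
Proof.
move=> /colP h; split.
- by have := h 0; rewrite !mxE.
- by have := h 1; rewrite !mxE.
- by have := h (2%:R : 'I_3); rewrite !mxE.
Qed.

Lemma vec3_0 : vec3 0 0 0 = 0.
Proof. by apply/colP => i; rewrite !mxE; case: i => [[|[|[|]]] //]. Qed.

Lemma vec3_eq0 x y z : (vec3 x y z == 0) = [&& x == 0, y == 0 & z == 0].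
Proof.
apply/eqP/and3P => [|[/eqP-> /eqP-> /eqP->]]; last exact: vec3_0.
by rewrite -vec3_0 => /vec3_inj[-> -> ->]; rewrite !eqxx.
Qed.

Lemma scale_vec3 a x y z : a *: vec3 x y z = vec3 (a * x) (a * y) (a * z).
Proof. by apply/colP => i; rewrite !mxE; case: i => [[|[|[|]]] //]. Qed.

Lemma add_vec3 x y z x' y' z' :
  vec3 x y z + vec3 x' y' z' = vec3 (x + x') (y + y') (z + z').
Proof. by apply/colP => i; rewrite !mxE; case: i => [[|[|[|]]] //]. Qed.

Lemma mem_line_vec3 x y z x' y' z' : vec3 x y z != 0 ->
  (vec3 x' y' z' \in <[vec3 x y z]>%VS) =
  [&& y * z' == z * y', z * x' == x * z' & x * y' == y * x'].
Proof.
move=> v0; apply/vlineP/and3P => [[k]|[/eqP h1 /eqP h2 /eqP h3]].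
  by rewrite scale_vec3 => /vec3_inj[-> -> ->]; split; apply/eqP; ring.
move: v0; rewrite vec3_eq0 !negb_and => /or3P[] n0.
- exists (x' / x); rewrite scale_vec3 divfK //; congr vec3.
    by rewrite mulrAC -[x' * y]mulrC -h3 mulrAC mulfV ?mul1r.
  by rewrite mulrAC -[x' * z]mulrC h2 mulrAC mulfV ?mul1r.
- exists (y' / y); rewrite scale_vec3 divfK //; congr vec3.
    by rewrite mulrAC -[y' * x]mulrC h3 mulrAC mulfV ?mul1r.
  by rewrite mulrAC -[y' * z]mulrC -h1 mulrAC mulfV ?mul1r.
- exists (z' / z); rewrite scale_vec3 divfK //; congr vec3.
    by rewrite mulrAC -[z' * x]mulrC -h2 mulrAC mulfV ?mul1r.
  by rewrite mulrAC -[z' * y]mulrC h1 mulrAC mulfV ?mul1r.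
Qed.

Lemma eq_line (u v : V) : u != 0 -> v != 0 ->
  (<[u]>%VS == <[v]>%VS) = (u \in <[v]>%VS).
Proof. by move=> u0 v0; rewrite eqEdim !dim_vline u0 v0 leqnn andbT. Qed.

Lemma lineP (L : {vspace V}) :
  line L <-> exists2 v, v != 0 & L = <[v]>%VS.
Proof.
split => [dL|[v v0 ->]]; last by rewrite /line /= dim_vline v0.
have v0 : vpick L != 0 by rewrite vpick0 -dimv_eq0 dL.
exists (vpick L) => //; apply/eqP; rewrite eq_sym eqEdim.
by rewrite dim_vline v0 dL leqnn andbT -memvE memv_pick.
Qed.

Definition elin (a : evec) (x y z : C) : C :=
  ev (e1 a) * x + ev (e2 a) * y + ev (e3 a) * z.
Lemma elinE a x y z :
  elin a x y z = ev (e1 a) * x + ev (e2 a) * y + ev (e3 a) * z.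
Proof. by []. Qed.

Definition evec_col (a : evec) : V := vec3 (ev (e1 a)) (ev (e2 a)) (ev (e3 a)).
Definition evec_row (a : evec) : 'rV[C]_3 := (evec_col a)^T.
Definition evm (A : emat) : 'M[C]_3 :=
  \matrix_(i, j) ev (nth eis0 (eseq (nth (r1 A) (rows A) i)) j).

Lemma evec_rowM a x y z : evec_row a *m vec3 x y z = (elin a x y z)%:M.
Proof.
apply/matrixP => i j; rewrite !ord1 !mxE !big_ord_recr big_ord0 /= !mxE /=.
by rewrite add0r.
Qed.

Lemma evmM A x y z : evm A *m vec3 x y z =
  vec3 (elin (r1 A) x y z) (elin (r2 A) x y z) (elin (r3 A) x y z).
Proof.
apply/colP => i; rewrite !mxE !big_ord_recr big_ord0 /= !mxE /= add0r.
by case: i => [[|[|[|]]] //].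
Qed.

Lemma ev_dot a b : ev (dot a b) = elin a (ev (e1 b)) (ev (e2 b)) (ev (e3 b)).
Proof. by rewrite /dot !(evD, evM) addrA. Qed.

Lemma evm_mul A B : evm (mmul A B) = evm A *m evm B.
Proof.
apply/matrixP => i j; rewrite !mxE !big_ord_recr big_ord0 /= !mxE /= add0r.
case: i => [[|[|[|]]] //] ?; case: j => [[|[|[|]]] //] ? /=;
  by rewrite ev_dot !elinE /=; congr (_ + _ + _); rewrite mulrC.
Qed.

Lemma evm_scal A c : evm (mmap (emul c) A) = ev c *: evm A.
Proof.
apply/matrixP => i j; rewrite !mxE.
by case: i => [[|[|[|]]] //] ?; case: j => [[|[|[|]]] //] ? /=; rewrite evM.
Qed.

Lemma evm_mscal c : evm (mscal c) = (ev c)%:M.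
Proof.
apply/matrixP => i j; rewrite !mxE.
by case: i => [[|[|[|]]] //] ?; case: j => [[|[|[|]]] //] ? /=; rewrite ?ev0.
Qed.

Lemma evm_sub A B : evm (msub A B) = evm A - evm B.
Proof.
apply/matrixP => i j; rewrite !mxE.
by case: i => [[|[|[|]]] //] ?; case: j => [[|[|[|]]] //] ? /=; rewrite evB.
Qed.

Lemma veqP u v : reflect (evec_col u = evec_col v) (veq u v).
Proof.
apply: (iffP idP) => [|/vec3_inj[/eeqP h1 /eeqP h2 /eeqP h3]].
  rewrite /veq; case: (eeqP R) => // h1; case: (eeqP R) => // h2 /(eeqP R) h3.
  by rewrite /evec_col h1 h2 h3.
by rewrite /veq h1 h2 h3.
Qed.

Lemma vec0bE u : vec0b u = (evec_col u == 0).
Proof. by rewrite vec3_eq0 !ev_eq0 /vec0b; case: ifP => //; case: ifP. Qed.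

Lemma row_evm A (i : 'I_3) : row i (evm A) = evec_row (nth (r1 A) (rows A) i).
Proof.
apply/rowP => j; rewrite !mxE.
by case: i => [[|[|[|]]] //] ?; case: j => [[|[|[|]]] //].
Qed.

Lemma meqP A B : reflect (evm A = evm B) (meq A B).
Proof.
apply: (iffP idP) => [|h].
  rewrite /meq; case: veqP => // h1; case: veqP => // h2 /veqP h3.
  apply/row_matrixP => i; rewrite !row_evm /evec_row.
  by case: i => [[|[|[|]]] //] ? /=; rewrite ?h1 ?h2 ?h3.
have r (i : 'I_3) : evec_col (nth (r1 A) (rows A) i) = evec_col (nth (r1 B) (rows B) i).
  by apply/trmx_inj; have := congr1 (row i) h; rewrite !row_evm.
have /veqP h1 := r 0; have /veqP h2 := r 1; have /veqP h3 := r (2%:R : 'I_3).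
by rewrite /meq h1 h2 h3.
Qed.

(** If a coordinate of u is nonzero, the vanishing of the cross product turns the product of this
    coordinate with the form v into a multiple of the form u. *)
Lemma parP u v x y z : par u v -> elin u x y z = 0 -> ~~ vec0b u ->
  elin v x y z = 0.
Proof.
rewrite /par !vec0bE !vec3_eq0 !evB !evM !subr_eq0 => /and3P[/eqP h1 /eqP h2 /eqP h3].
rewrite !elinE; set a := ev (e1 u) in h2 h3 *; set b := ev (e2 u) in h1 h3 *.
set c := ev (e3 u) in h1 h2 *.
set a' := ev (e1 v) in h2 h3 *; set b' := ev (e2 v) in h1 h3 *.
set c' := ev (e3 v) in h1 h2 * => h; rewrite !negb_and => /or3P[] n0;
  apply: (mulfI n0); rewrite mulr0.
- transitivity (a' * (a * x + b * y + c * z)); last by rewrite h mulr0.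
  by rewrite !mulrDr !mulrA h3 -h2; ring.
- transitivity (b' * (a * x + b * y + c * z)); last by rewrite h mulr0.
  by rewrite !mulrDr !mulrA -h3 h1; ring.
- transitivity (c' * (a * x + b * y + c * z)); last by rewrite h mulr0.
  by rewrite !mulrDr !mulrA h2 -h1; ring.
Qed.

End Vectors.

(** * The group as an explicit list *)

Definition evec_prod (v : evec) := (e1 v, e2 v, e3 v).
Definition prod_evec t := EVec t.1.1 t.1.2 t.2.
Lemma evec_prodK : cancel evec_prod prod_evec. Proof. by case. Qed.
HB.instance Definition _ := Equality.copy evec (can_type evec_prodK).

Definition emat_prod (A : emat) := (r1 A, r2 A, r3 A).
Definition prod_emat t := EMat t.1.1 t.1.2 t.2.
Lemma emat_prodK : cancel emat_prod prod_emat. Proof. by case. Qed.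
HB.instance Definition _ := Equality.copy emat (can_type emat_prodK).

Lemma hasbE (T : Type) (p : T -> bool) s : hasb p s = has p s.
Proof. by elim: s => //= x s ->; case: (p x). Qed.

Lemma closedb_true : closedb. Proof. by vm_compute. Qed.
Lemma exactb_true : exactb. Proof. by vm_compute. Qed.
Lemma uniqb_true : uniqb Gl. Proof. by vm_compute. Qed.
Lemma GlE : Gl = [seq gword w | w <- words]. Proof. by vm_compute. Qed.
Lemma size_Gl : size Gl = 648%N. Proof. by vm_compute. Qed.

(* Unification would otherwise evaluate the 648 matrices. *)
Opaque Gl words gmul mmul.

Section Group.
Variable R : realType.
Local Notation C := R[i].
Local Notation w := (@omega R).
Local Notation ev := (@ev R).
Local Notation evm := (@evm R).

Definition gC (A : emat) : 'M[C]_3 := (ev eistheta)^-1 *: evm A.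

Lemma gC_scal A : gC (mmap (emul eistheta) A) = evm A.
Proof. by rewrite /gC evm_scal scalerA mulVf ?scale1r // ev_theta_neq0. Qed.

Lemma evm_gC A : evm A = ev eistheta *: gC A.
Proof. by rewrite scalerA mulfV ?scale1r // ev_theta_neq0. Qed.

Lemma gC_inj A B : gC A = gC B -> meq A B.
Proof. by move=> h; apply/(meqP R); rewrite !evm_gC h. Qed.

Lemma gC1 : gC g1 = 1%:M.
Proof. by rewrite gC_scal (evm_mscal R eis1) ev1. Qed.

Lemma gC_R1 : gC gR1 = G25_R1.
Proof.
rewrite gC_scal; apply/matrixP => i j; rewrite !mxE.
by case: i => [[|[|[|]]] //] ?; case: j => [[|[|[|]]] //] ? /=;
  rewrite ?ev0 ?ev1 ?evw2.
Qed.

Lemma gC_R3 : gC gR3 = G25_R3.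
Proof.
rewrite gC_scal; apply/matrixP => i j; rewrite !mxE.
by case: i => [[|[|[|]]] //] ?; case: j => [[|[|[|]]] //] ? /=;
  rewrite ?ev0 ?ev1 ?evw2.
Qed.

Lemma gC_R2 : gC gR2 = G25_R2.
Proof.
(* theta = omega - omega ^ 2 has square -3, so its inverse is - theta / 3, the prefactor of R2. *)
rewrite /gC /G25_R2; have -> : (ev eistheta)^-1 = (w ^+ 2 - w) / 3.
  apply: (mulfI (ev_theta_neq0 R)); rewrite mulfV ?ev_theta_neq0 //.
  by rewrite -[eistheta]/(esub eisw eisw2) evB evw evw2 omega2E; field: (omega2E R).
apply/matrixP => i j; rewrite !mxE; congr (_ * _).
by case: i => [[|[|[|]]] //] ?; case: j => [[|[|[|]]] //] ? /=;
  rewrite ?evw ?evw2.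
Qed.

Lemma gC_gmul A B : meq (mmap (emul eistheta) (gmul A B)) (mmul A B) ->
  gC (gmul A B) = gC A *m gC B.
Proof.
move=> /(meqP R); rewrite evm_mul !evm_gC gC_scal => h.
apply: (scalerI (ev_theta_neq0 R)); rewrite -evm_gC.
by apply: (scalerI (ev_theta_neq0 R)); rewrite h -scalemxAl -scalemxAr.
Qed.

Definition Gs : seq 'M[C]_3 := [seq gC A | A <- Gl].

(** Each listed matrix is the value of a word in the generators, and the flag computed by [gstep]
    certifies that no division by theta along the word was rounded. *)
Lemma Gs_ind (P : 'M[C]_3 -> Prop) :
  P 1%:M -> P G25_R1 -> P G25_R2 -> P G25_R3 ->
  (forall g h, P g -> P h -> P (g *m h)) -> forall g, g \in Gs -> P g.
Proof.
move=> P1 PR1 PR2 PR3 PM _ /mapP[A + ->]; rewrite GlE => /mapP[u ul ->].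
(* An index outside the list of generators gives the identity. *)
have gen i : P (gC (nth g1 gens i)).
  by case: i => [|[|[|i]]] /=;
    rewrite ?gC_R1 ?gC_R2 ?gC_R3 // nth_nil gC1.
have : (foldr gstep (true, g1) u).1 by have := exactb_true; rewrite /exactb => /allP; apply.
have step v : (foldr gstep (true, g1) v).2 = gword v by elim: v => //= i v ->.
elim: u {ul} => [|i u IH] /=; first by rewrite gC1.
by rewrite step => /andP[/IH Pu h]; rewrite gC_gmul //; apply: PM.
Qed.

Lemma uniq_Gs : uniq Gs.
Proof.
rewrite /Gs; elim: Gl uniqb_true => //= x s IH.
rewrite hasbE; case: ifP => // /negbT/hasPn nx /IH ->; rewrite andbT.
by apply/mapP => -[y /nx /negP ny /gC_inj].
Qed.

Lemma size_Gs : size Gs = 648%N. Proof. by rewrite size_map size_Gl. Qed.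

Lemma Gs1 : 1%:M \in Gs.
Proof. by rewrite -gC1; apply: map_f; rewrite GlE; apply/mapP; exists [::]. Qed.

Lemma Gs_gen i g : g \in Gs -> gC (nth g1 gens i) *m g \in Gs.
Proof.
case: (ltnP i 3) => [i3|]; last by move=> i3; rewrite nth_default // gC1 mul1mx.
move=> /mapP[A AG ->].
have : hasb (fun k => meq (mmul (nth g1 gens i) A) (mmap (emul eistheta) k)) Gl.
  have := closedb_true; rewrite /closedb => /allP/(_ _ (mem_nth g1 (i3 : (i < size gens)%N))).
  by move=> /allP; apply.
rewrite hasbE => /hasP[B BG /(meqP R)]; rewrite evm_mul evm_scal !evm_gC.
rewrite -scalemxAl -scalemxAr => /(scalerI (ev_theta_neq0 R)).
by move=> /(scalerI (ev_theta_neq0 R)) ->; apply: map_f.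
Qed.

Lemma Gs_mul g h : g \in Gs -> h \in Gs -> g *m h \in Gs.
Proof.
move=> gG; move: g gG h; apply: Gs_ind => [h|h|h|h|g k IHg IHk h hG].
- by rewrite mul1mx.
- by rewrite -gC_R1; apply: (@Gs_gen 0).
- by rewrite -gC_R2; apply: (@Gs_gen 1).
- by rewrite -gC_R3; apply: (@Gs_gen 2).
- by rewrite -mulmxA; apply/IHg/IHk.
Qed.

Lemma Gs_gens : [/\ G25_R1 \in Gs, G25_R2 \in Gs & G25_R3 \in Gs].
Proof.
rewrite -gC_R1 -gC_R2 -gC_R3.
by split; [have := @Gs_gen 0 _ Gs1 | have := @Gs_gen 1 _ Gs1 |
  have := @Gs_gen 2 _ Gs1]; rewrite mulmx1.
Qed.

Lemma gens_cube i : let s := gC (nth g1 gens i) in s *m (s *m s) = 1%:M.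
Proof.
have e s : meq (mmul s (mmul s s)) (mscal (emul eistheta (emul eistheta eistheta))) ->
  gC s *m (gC s *m gC s) = 1%:M.
  move=> /(meqP R); rewrite !evm_mul evm_mscal !evM => h.
  rewrite /gC; move: (evm s) (ev eistheta) (ev_theta_neq0 R) h => M t t0 h.
  rewrite -!scalemxAl -!scalemxAr !scalerA h scale_scalar_mx.
  by congr (_%:M); field.
by case: i => [|[|[|i]]]; apply: e; rewrite /= ?nth_nil; vm_compute.
Qed.

(** The generators have order 3, so their squares supply the inverses without a search in the
    list. *)
Lemma Gs_inv g : g \in Gs -> exists2 h, h \in Gs & h *m g = 1%:M.
Proof.
have [G1 G2 G3] := Gs_gens.
move: g; apply: Gs_ind => [||||g h [g' g'G g'g] [h' h'G h'h]].
- by exists 1%:M; rewrite ?Gs1 ?mul1mx.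
- by exists (G25_R1 *m G25_R1); [exact: Gs_mul |
    rewrite -mulmxA; have := gens_cube 0; rewrite gC_R1].
- by exists (G25_R2 *m G25_R2); [exact: Gs_mul |
    rewrite -mulmxA; have := gens_cube 1; rewrite gC_R2].
- by exists (G25_R3 *m G25_R3); [exact: Gs_mul |
    rewrite -mulmxA; have := gens_cube 2; rewrite gC_R3].
- exists (h' *m g'); first exact: Gs_mul.
  by rewrite -mulmxA (mulmxA g') g'g mul1mx.
Qed.

Lemma Gs_unit g : g \in Gs -> g \in unitmx.
Proof. by move=> /Gs_inv[h _ /mulmx1_unit[]]. Qed.

Lemma Gs_invmx g : g \in Gs -> invmx g \in Gs.
Proof.
move=> gG; have [h hG hg] := Gs_inv gG.
by rewrite -[invmx g]mul1mx -hg mulmxK // Gs_unit.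
Qed.

(** The list is a subgroup containing the generators, which gives one inclusion; its elements are
    words in the generators, which gives the other. *)
Lemma G25E : @G25 R = [set` Gs].
Proof.
apply/seteqP; split => g /=.
  move=> /(_ [set` Gs]); apply; split.
    split => [h /= /Gs_unit // | | h k /= | h /=]; first exact: Gs1.
      exact: Gs_mul.
    exact: Gs_invmx.
  by have [G1 G2 G3] := Gs_gens; move=> h /= [[->|->]|->].
move: g; apply: Gs_ind => [||||g h gG hG] H [[H1 H2 H3 H4] sH].
- exact: H2.
- by apply: sH => /=; left; left.
- by apply: sH => /=; left; right.
- by apply: sH => /=; right.
- by have c := conj (And4 H1 H2 H3 H4) sH; exact: H3 (gG H c) (hG H c).
Qed.

Lemma G25P g : G25 g <-> g \in Gs. Proof. by rewrite G25E. Qed.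

End Group.

Lemma card_set_seq (T : eqType) (s : seq T) : uniq s -> ([set` s] #= `I_(size s))%card.
Proof.
case: s => [|x s] us; first by rewrite II0 set_nil card_eq_sym.
set t := x :: s; have -> : [set` t] = nth x t @` `I_(size t).
  apply/seteqP; split => [y /= /(nthP x)[i lti <-]|_ /= [i lti <-]].
    by exists i.
  exact: mem_nth.
apply: inj_card_eq => i j; rewrite !inE /= => hi hj /eqP.
by rewrite nth_uniq // => /eqP.
Qed.

(** * Planes as kernels of linear forms *)

Section Planes.
Variable R : realType.
Local Notation C := R[i].
Local Notation V := 'cV[C]_3.
Local Notation ev := (@ev R).

Definition hyp (a : 'rV[C]_3) : {vspace V} := lker (linfun (mulmx a : V -> 'M[C]_1)).

Lemma mem_hyp a v : (v \in hyp a) = (a *m v == 0).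
Proof. by rewrite memv_ker lfunE. Qed.

Lemma dim_hyp a : a != 0 -> \dim (hyp a) = 2.
Proof.
move=> a0; have := limg_ker_dim (linfun (mulmx a : V -> 'M[C]_1)) fullv.
rewrite capfv dimvf /dim /= => e.
suff d : \dim (limg (linfun (mulmx a : V -> 'M[C]_1))) = 1.
  by move: e; rewrite d addn1 => -[].
apply/eqP; rewrite eqn_leq; apply/andP; split.
  by rewrite (leq_trans (dimvS (subvf _))) // dimvf.
rewrite lt0n dimv_eq0; apply: contra a0 => /eqP h0.
apply/eqP/rowP => i; have : linfun (mulmx a : V -> 'M[C]_1) (delta_mx i 0) \in 0%VS.
  by rewrite -h0 memv_img ?memvf.
rewrite memv0 lfunE /= -colE => /eqP /colP /(_ 0).
by rewrite !mxE.
Qed.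

Lemma hyp_eq (H : {vspace V}) a : \dim H = 2 -> a != 0 -> (H <= hyp a)%VS -> H = hyp a.
Proof. by move=> dH a0 sH; apply/eqP; rewrite eqEdim sH dim_hyp // dH. Qed.

Definition ehyp (a : evec) : {vspace V} := hyp (evec_row R a).

Lemma mem_ehyp a x y z : (vec3 x y z \in ehyp a) = (elin a x y z == 0).
Proof.
rewrite mem_hyp evec_rowM; apply/eqP/eqP => [/matrixP/(_ 0 0)|->].
  by rewrite !mxE mulr1n.
by rewrite raddf0.
Qed.

Lemma evec_row_eq0 a : (evec_row R a == 0) = vec0b a.
Proof. by rewrite (vec0bE R) -(inj_eq trmx_inj) trmxK trmx0. Qed.

Lemma ehyp_par a b : ~~ vec0b a -> ~~ vec0b b -> par a b -> ehyp a = ehyp b.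
Proof.
move=> a0 b0 ab; have ra : evec_row R a != 0 by rewrite evec_row_eq0.
have rb : evec_row R b != 0 by rewrite evec_row_eq0.
rewrite /ehyp; apply: (hyp_eq (dim_hyp ra) rb).
apply/subvP => v; have [x [y [z ->]]] := vec3_surj v => va.
have /eqP h : elin a x y z == 0 by rewrite -mem_ehyp.
by rewrite -/(ehyp b) mem_ehyp (parP ab h a0).
Qed.

Lemma par_ehyp a b : ehyp a = ehyp b -> par a b.
Proof.
move=> e; have on_b (x y z : C) : elin a x y z = 0 -> elin b x y z = 0.
  by move=> h; apply/eqP; rewrite -(mem_ehyp b) -e (mem_ehyp a) h.
rewrite /par (vec0bE R) vec3_eq0 !evB !evM.
(* The cross products of a with the basis vectors lie on the plane a; the values of b at these
   points are the coordinates of the cross product of a and b. *)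
have h1 := on_b 0 (- ev (e3 a)) (ev (e2 a)).
have h2 := on_b (ev (e3 a)) 0 (- ev (e1 a)).
have h3 := on_b (- ev (e2 a)) (ev (e1 a)) 0.
rewrite !elinE in h1 h2 h3; apply/and3P; split; apply/eqP.
- by rewrite -[RHS]h1; ring.
- by rewrite -[RHS]h2; ring.
- by rewrite -[RHS]h3; ring.
Qed.

Lemma endoE (g : 'M[C]_3) v : endo g v = g *m v.
Proof. by rewrite lfunE. Qed.

Lemma endo_line (g : 'M[C]_3) (v : V) : (endo g @: <[v]>)%VS = <[g *m v]>%VS.
Proof. by rewrite limg_line endoE. Qed.

Lemma mem_leigenspace (g : 'M[C]_3) z v :
  (v \in passmx.leigenspace (endo g) z) = (g *m v == z *: v).
Proof.
by rewrite memv_ker add_lfunE opp_lfunE scale_lfunE id_lfunE endoE subr_eq0.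
Qed.

Lemma proj_ptE (x y z : C) : proj_pt x y z = <[vec3 x y z]>%VS.
Proof. by []. Qed.

End Planes.

(** * Reflection planes and proper planes *)

Definition refl_forms : seq evec :=
  [:: EVec eis1 eis0 eis0; EVec eis0 eis1 eis0; EVec eis0 eis0 eis1] ++
  [seq EVec eis1 a b | a <- eunits, b <- eunits].
(** The mirrors of the nine reflections s of order 2 such that -s is in the group. Multiplying -s by
    the scalar omega, also in the group, gives the eigenvalue -omega of order 6 on the mirror. *)
Definition proper_forms : seq evec :=
  [seq EVec eis1 (eopp a) eis0 | a <- eunits] ++
  [seq EVec eis1 eis0 (eopp a) | a <- eunits] ++
  [seq EVec eis0 eis1 (eopp a) | a <- eunits].

(** These are the rows of theta * (g - z), that is, equations of the eigenspace of g for z. *)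
Definition eig (A : emat) (z : eis) : seq evec :=
  rows (msub A (mscal (emul eistheta z))).

Definition eis6 : seq eis := [:: eopp eisw; eopp eisw2].

(* If g fixes a plane pointwise, the nonzero rows of g - 1 are proportional to
   its equation; so either one of them is a known form, or two are independent. *)
Definition refl_check (A : emat) : bool :=
  let E := eig A eis1 in
  if all vec0b E then true else
  hasb (fun r => if vec0b r then false else
    if hasb (par r) refl_forms then true else hasb (fun s => ~~ par r s) E) E.

(* An eigenspace that is not one of the planes lies, if two rows r and s of
   g - z are independent, on the line of their cross product; this line is on
   a reflection plane, or it is not in the kernel of a third row. *)
Definition proper_check (A : emat) (z : eis) : bool :=
  let E := eig A z in
  if hasb (fun r => if vec0b r then false else
       hasb (fun m => all (par m) E) proper_forms) E then true else
  hasb (fun r => hasb (fun s => let c := cross r s in if vec0b c then false else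
    if hasb (fun l => eis0b (dot l c)) refl_forms then true
    else hasb (fun t => ~~ eis0b (dot t c)) E) E) E.

(** One vector on each proper plane. It is off the reflection planes because its coordinates are
    nonzero and twice a cube root of unity is never cancelled by two others. *)
Definition regular_vecs : seq evec :=
  let two := (Zpos 2, Z0) in
  [seq EVec two eis1 a | a <- eunits] ++ [seq EVec eis1 two a | a <- eunits] ++
  [seq EVec eis1 a two | a <- eunits].

Lemma refl_check_true : all refl_check Gl. Proof. by vm_compute. Qed.
Lemma refl_forms_check : all (fun l => hasb (fun A => if meq A g1 then false else
  all (par l) (eig A eis1)) Gl) refl_forms.
Proof. by vm_compute. Qed.
Lemma proper_check_true : all (fun A => all (proper_check A) eis6) Gl.
Proof. by vm_compute. Qed.
Lemma proper_forms_check : all (fun m =>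
  if hasb (fun v => if eis0b (dot m v) then all (fun l => ~~ eis0b (dot l v)) refl_forms
    else false) regular_vecs then
  hasb (fun A => hasb (fun z => let E := eig A z in
    if all vec0b E then false else all (par m) E) eis6) Gl else false) proper_forms.
Proof. by vm_compute. Qed.
Lemma refl_forms_neq0 : all (fun l => ~~ vec0b l) refl_forms. Proof. by []. Qed.
Lemma proper_forms_neq0 : all (fun l => ~~ vec0b l) proper_forms. Proof. by []. Qed.
Lemma refl_forms_pairwise : pairwise (fun u v => ~~ par u v) refl_forms.
Proof. by vm_compute. Qed.
Lemma proper_forms_pairwise : pairwise (fun u v => ~~ par u v) proper_forms.
Proof. by vm_compute. Qed.


Section PlaneLists.
Variable R : realType.
Local Notation C := R[i].
Local Notation V := 'cV[C]_3.
Local Notation w := (@omega R).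
Local Notation ev := (@ev R).
Local Notation gC := (@gC R).
Local Notation ehyp := (@ehyp R).
Local Notation Gs := (@Gs R).

Lemma eigP A z x y t :
  reflect (gC A *m vec3 x y t = ev z *: vec3 x y t)
          (all (fun r => elin r x y t == 0) (eig A z)).
Proof.
apply: (iffP idP) => [|h].
  rewrite /= andbT => /and3P[/eqP h1 /eqP h2 /eqP h3].
  apply: (scalerI (ev_theta_neq0 R)); rewrite scalemxAl -evm_gC; apply/eqP.
  rewrite -subr_eq0 scalerA -evM -mul_scalar_mx -evm_mscal -mulmxBl -evm_sub.
  by rewrite evmM h1 h2 h3 vec3_0.
have : evm R (msub A (mscal (emul eistheta z))) *m vec3 x y t = 0.
  rewrite evm_sub mulmxBl evm_mscal mul_scalar_mx evm_gC -scalemxAl h evM.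
  by rewrite scalerA subrr.
by rewrite evmM -vec3_0 /= => /vec3_inj[-> -> ->]; rewrite eqxx.
Qed.

Lemma all_par_elin m (E : seq evec) x y t : ~~ vec0b m -> all (par m) E ->
  @elin R m x y t = 0 -> all (fun r => @elin R r x y t == 0) E.
Proof.
move=> m0 /allP mE h; apply/allP => r /mE mr; apply/eqP; exact: parP mr h m0.
Qed.

Lemma uniq_ehyp s : all (fun l => ~~ vec0b l) s ->
  pairwise (fun u v => ~~ par u v) s -> uniq (map ehyp s).
Proof.
move=> _ ps; rewrite uniq_pairwise pairwise_map.
by apply: sub_pairwise ps => u v; apply: contra => /eqP /par_ehyp.
Qed.

Lemma reflection_planeP (H : {vspace V}) :
  reflection_plane H <-> H \in map ehyp refl_forms.
Proof.
split.
  move=> [dH [g /G25P/mapP[A AG ->] [g1' fixH]]].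
  have := allP refl_check_true _ AG; rewrite /refl_check.
  have sub r : r \in eig A eis1 -> (H <= ehyp r)%VS.
    move=> rE; apply/subvP => v; have [x [y [z ->]]] := vec3_surj v => vH.
    have /eigP/allP/(_ r rE) : gC A *m vec3 x y z = ev eis1 *: vec3 x y z.
      by rewrite ev1 scale1r fixH.
    by rewrite mem_ehyp.
  have eqr r : r \in eig A eis1 -> ~~ vec0b r -> H = ehyp r.
    by move=> rE r0; apply: hyp_eq => //; [rewrite evec_row_eq0 | exact: sub].
  case: ifP => [E0 _|_].
    case/eqP: g1'; apply/matrixP => i j.
    have [x [y [z e]]] := vec3_surj (delta_mx j 0 : V).
    have /eigP : all (fun r => elin r x y z == 0) (eig A eis1).
      apply/allP => r /(allP E0) r0; apply/eqP; move: r0.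
      rewrite (vec0bE R) vec3_eq0 !elinE => /and3P[/eqP-> /eqP-> /eqP->].
      by rewrite !mul0r !addr0.
    by rewrite -e ev1 scale1r -colE => /colP /(_ i); rewrite !mxE eqxx andbT eq_sym.
  rewrite hasbE => /hasP[r rE]; case: ifP => // /negbT r0; rewrite !hasbE.
  case: ifP => [/hasP[l ll rl] _|_ /hasP[s sE rs]].
    suff -> : H = ehyp l by apply: map_f.
    by rewrite (eqr r rE r0); apply: ehyp_par => //; exact: (allP refl_forms_neq0).
  have s0 : ~~ vec0b s.
    apply: contra rs; rewrite /par !(vec0bE R) !vec3_eq0 !evB !evM.
    by move=> /and3P[/eqP-> /eqP-> /eqP->]; rewrite !mulr0 subrr eqxx.
  by case/negP: rs; apply/(@par_ehyp R); rewrite -(eqr r rE r0) (eqr s sE s0).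
move=> /mapP[l lF ->]; have l0 := allP refl_forms_neq0 l lF.
split; first by apply: dim_hyp; rewrite evec_row_eq0.
have := allP refl_forms_check l lF; rewrite hasbE => /hasP[A AG].
case: ifP => // /negP nA lA; exists (gC A); first exact/G25P/map_f.
split; first by apply/eqP; rewrite -gC1 => /gC_inj.
move=> v; have [x [y [z ->]]] := vec3_surj v; rewrite mem_ehyp => /eqP h.
have /eigP -> := all_par_elin l0 lA h.
by rewrite ev1 scale1r.
Qed.

(** The primitive sixth roots of unity are the roots of t ^ 2 - t + 1 = (t + omega) * (t + omega ^
    2). Conversely z ^ 2 = z - 1 gives z ^ 3 = -1, and the proper divisors of 6 are excluded as
    orders. *)
Lemma prim6P (z : C) : 6.-primitive_root z <-> exists2 u, u \in eis6 & z = ev u.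
Proof.
have fac (t : C) : t ^+ 2 - t + 1 = (t + w) * (t + w ^+ 2).
  by rewrite omega2E; ring: (omega2E R).
split => [z6|[u u6 zu]].
  have z61 := prim_expr_order z6.
  have n (k : nat) : (0 < k < 6)%N -> z ^+ k != 1.
    move=> /andP[k0 k6]; rewrite -(prim_order_dvd z6).
    by apply: contraTN k6 => /dvdn_leq; rewrite -leqNgt; apply.
  have z3 : z ^+ 3 = -1.
    apply/eqP; rewrite -subr_eq0 opprK; have := n 3 isT.
    rewrite -subr_eq0 => /mulfI/inj_eq <-; rewrite mulr0 -subr_sqr_1 -exprM z61.
    by rewrite subrr.
  have : (z + w) * (z + w ^+ 2) == 0.
    rewrite -fac; have : z + 1 != 0.
      apply: contraTN (n 2 isT) => /eqP h; rewrite negbK.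
      have -> : z = -1 by apply/eqP; rewrite -subr_eq0 opprK h.
      by rewrite sqrrN expr1n.
    move=> /mulfI/inj_eq <-; rewrite mulr0; apply/eqP.
    by transitivity (z ^+ 3 + 1); [ring | rewrite z3 addNr].
  rewrite mulf_eq0 !addr_eq0 => /orP[]/eqP->.
    by exists (eopp eisw); rewrite ?inE ?eqxx // evN evw.
  by exists (eopp eisw2); rewrite ?inE ?eqxx ?orbT // evN evw2.
have z2 : z ^+ 2 = z - 1.
  apply/eqP; rewrite -subr_eq0; apply/eqP.
  transitivity ((z + w) * (z + w ^+ 2)); first by rewrite -fac; ring.
  by move: u6 zu; rewrite !inE => /orP[]/eqP-> ->;
    rewrite evN ?evw ?evw2 addNr ?mul0r ?mulr0.
have z3 : z ^+ 3 = -1 by rewrite exprS z2; ring: z2.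
have z6 : z ^+ 6 = 1 by rewrite -[6%N]/(3 * 2)%N exprM z3 sqrrN expr1n.
have n1 : z != 1.
  apply/eqP => e; move: z3; rewrite e expr1n => /eqP.
  by rewrite -subr_eq0 opprK -(natrD _ 1 1) pnatr_eq0.
have [m mp /dvdnP[q mq]] := prim_order_exists (isT : (0 < 6)%N) z6.
have mx : z ^+ m = 1 by exact: prim_expr_order.
suff -> : 6%N = m by [].
have m0 := prim_order_gt0 mp.
have : (m <= 6)%N by rewrite mq leq_pmull // lt0n; apply/eqP => q0; rewrite q0 in mq.
case: m mx m0 mq {mp} => [|[|[|[|[|[|[|m]]]]]]] //; rewrite ?expr1.
- by move=> e; rewrite e eqxx in n1.
- move=> e; move: z3; rewrite exprS e mulr1 => e'; move: z2; rewrite e e'.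
  move=> /eqP; rewrite -subr_eq0 opprB addrA opprK -!(natrD _ 1 1) -(natrD _ 2 1).
  by rewrite pnatr_eq0.
- by rewrite z3 => /eqP; rewrite eq_sym -subr_eq0 opprK -(natrD _ 1 1) pnatr_eq0.
- by move=> _ _ h; have := congr1 (modn^~ 4) h; rewrite modnMl.
- by move=> _ _ h; have := congr1 (modn^~ 5) h; rewrite modnMl.
Qed.

End PlaneLists.

(** * Orbits and their sizes *)

Section Orbits.
Variable R : realType.
Local Notation C := R[i].
Local Notation V := 'cV[C]_3.
Local Notation ev := (@ev R).
Local Notation gC := (@gC R).
Local Notation ehyp := (@ehyp R).
Local Notation Gs := (@Gs R).
Implicit Types (g h : 'M[C]_3) (H L : {vspace V}).

Lemma par_sym u v : par u v = par v u.
Proof.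
rewrite /par !(vec0bE R) !vec3_eq0 !evB !evM.
by congr [&& _, _ & _]; rewrite -oppr_eq0 opprB; congr (_ == 0); ring.
Qed.

Lemma leigenspace_ehyp A u m r : r \in eig A u -> ~~ vec0b r -> ~~ vec0b m ->
  all (par m) (eig A u) -> passmx.leigenspace (endo (gC A)) (ev u) = ehyp m.
Proof.
move=> rE r0 m0 mE; apply/vspaceP => v; have [x [y [z ->]]] := vec3_surj v.
rewrite [LHS]mem_leigenspace [RHS]mem_ehyp (sameP eqP (eigP A u x y z)).
apply/idP/eqP => [/allP/(_ r rE)/eqP h|h]; last exact: all_par_elin mE h.
by apply: parP h r0; rewrite par_sym; apply: (allP mE).
Qed.

Lemma regularP x y z : regular_vector (vec3 x y z) <->
  all (fun l => @elin R l x y z != 0) refl_forms.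
Proof.
split => [h|/allP h H /reflection_planeP/mapP[l /h l0 ->]]; last by rewrite mem_ehyp.
apply/allP => l lF; rewrite -mem_ehyp; apply: h.
by apply/reflection_planeP/map_f.
Qed.

Lemma cross_line r s x y z : @elin R r x y z = 0 -> @elin R s x y z = 0 ->
  ~~ vec0b (cross r s) -> vec3 x y z \in <[evec_col R (cross r s)]>%VS.
Proof.
rewrite (vec0bE R) => hr hs c0; rewrite mem_line_vec3 // !evB !evM.
rewrite !elinE in hr hs; apply/and3P; split; rewrite -subr_eq0; apply/eqP.
- transitivity (ev (e1 s) * 0 - ev (e1 r) * (0 : C)); last by rewrite !mulr0 subrr.
  by rewrite -{1}hr -hs; ring.
- transitivity (ev (e2 s) * 0 - ev (e2 r) * (0 : C)); last by rewrite !mulr0 subrr.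
  by rewrite -{1}hr -hs; ring.
- transitivity (ev (e3 s) * 0 - ev (e3 r) * (0 : C)); last by rewrite !mulr0 subrr.
  by rewrite -{1}hr -hs; ring.
Qed.

Lemma elinZ a k x y z : @elin R a (k * x) (k * y) (k * z) = k * elin a x y z.
Proof. by rewrite !elinE; ring. Qed.

Lemma proper_planeP H : proper_plane H <-> H \in map ehyp proper_forms.
Proof.
split.
  move=> [[v vH vreg] [g [z [/G25P/mapP[A AG ->] /prim6P[u u6 ->] He]]]].
  have := allP (allP proper_check_true A AG) u u6; rewrite /proper_check.
  rewrite hasbE; case: ifP => [/hasP[r rE]|_].
    case: ifP => // /negbT r0; rewrite hasbE => /hasP[m mF mE] _.
    suff -> : H = ehyp m by apply: map_f.
    by rewrite He; apply: leigenspace_ehyp rE r0 _ mE; apply: (allP proper_forms_neq0).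
  rewrite hasbE => /hasP[r rE]; rewrite hasbE => /hasP[s sE].
  case: ifP => // /negbT c0; rewrite !hasbE.
  move: v vH vreg => v; have [x [y [t ->]]] := vec3_surj v.
  rewrite He mem_leigenspace => /eqP/eigP/allP vE /regularP/allP vreg.
  have /vlineP[k] := cross_line (eqP (vE r rE)) (eqP (vE s sE)) c0.
  rewrite scale_vec3 => /vec3_inj[ex ey et].
  have ev_c a : @elin R a x y t = k * ev (dot a (cross r s)).
    by rewrite ex ey et elinZ -ev_dot.
  case: ifP => [/hasP[l lF l0] _|_ /hasP[a aE a0]].
    by have := vreg l lF; rewrite ev_c -[eis0b _](ev_eq0 R) in l0 *; rewrite (eqP l0) mulr0 eqxx.
  (* The third row forces the vector to be zero, but a regular vector is not on x = 0. *)
  have := vE a aE; rewrite ev_c mulf_eq0 ev_eq0 (negPf a0) orbF => /eqP k0.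
  have := allP refl_forms_neq0; have l0 : EVec eis1 eis0 eis0 \in refl_forms by [].
  by have := vreg _ l0; rewrite ev_c k0 mul0r eqxx.
move=> /mapP[m mF ->]; have m0 := allP proper_forms_neq0 m mF.
have := allP proper_forms_check m mF; rewrite hasbE; case: ifP => // /hasP[v _].
case: ifP => // mv0 vreg; rewrite hasbE => /hasP[A AG]; rewrite hasbE => /hasP[u u6].
cbv zeta; case: ifP => // /negbT/allPn[r rE r0] mE; split.
  exists (evec_col R v); first by rewrite mem_ehyp -ev_dot ev_eq0.
  apply/regularP/allP => l lF; rewrite -ev_dot ev_eq0.
  exact: (allP vreg).
exists (gC A), (ev u); split; first exact/G25P/map_f.
  by apply/prim6P; exists u.
by rewrite (leigenspace_ehyp rE r0 m0 mE).
Qed.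

Lemma sum_count_undup (T : eqType) (s : seq T) :
  (\sum_(x <- undup s) count_mem x s = size s)%N.
Proof.
rewrite -[RHS](perm_size (perm_count_undup s)) size_flatten /shape -map_comp.
by rewrite sumnE big_map; apply: eq_bigr => x _; rewrite /= size_nseq.
Qed.

Lemma mem_line_unit g (u v : V) : g \in unitmx ->
  (g *m u \in <[g *m v]>%VS) = (u \in <[v]>%VS).
Proof.
move=> gu; apply/vlineP/vlineP => -[k e]; exists k; last by rewrite e scalemxAr.
by rewrite -(mulKmx gu u) e -scalemxAr mulKmx.
Qed.

Lemma mulmx_eq0 g (v : V) : g \in unitmx -> (g *m v == 0) = (v == 0).
Proof.
move=> gu; apply/eqP/eqP => [e|->]; last by rewrite mulmx0.
by rewrite -(mulKmx gu v) e mulmx0.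
Qed.

Lemma perm_Gs g : g \in Gs -> perm_eq [seq g *m h | h <- Gs] Gs.
Proof.
move=> gG; have inj : injective (mulmx g : 'M_3 -> 'M_3).
  by move=> h k e; rewrite -(mulKmx (Gs_unit gG) h) e mulKmx // Gs_unit.
have um : uniq [seq g *m h | h <- Gs] by rewrite map_inj_uniq // uniq_Gs.
have sub : {subset [seq g *m h | h <- Gs] <= Gs}.
  by move=> _ /mapP[h hG ->]; apply: Gs_mul.
apply: (uniq_perm um (uniq_Gs R)).
by have [] := uniq_min_size um sub (eq_leq (esym (size_map _ _))).
Qed.

Lemma line_orbitE v : line_orbit <[v]>%VS = [set <[g *m v]>%VS | g in [set` Gs]].
Proof.
by rewrite /line_orbit G25E; apply: eq_imagel => g _; rewrite endo_line.
Qed.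

(** Orbit-stabilizer: in the list of the 648 images of the line, left translation by g shows that
    its image under g occurs as often as the line itself. All multiplicities thus equal the order of
    the stabilizer. *)
Lemma card_line_orbit v n : v != 0 ->
  (count (fun g => g *m v \in <[v]>%VS) Gs * n = 648)%N ->
  (line_orbit <[v]>%VS #= `I_n)%card.
Proof.
move=> v0 kn; pose f g := <[g *m v]>%VS; pose U := undup (map f Gs).
have -> : line_orbit <[v]>%VS = [set` U].
  rewrite line_orbitE; apply/seteqP; split => L.
    by move=> [g /= gG <-]; rewrite mem_undup; exact: (map_f f gG).
  by rewrite /= mem_undup => /mapP[g gG ->]; exists g.
suff -> : n = size U by apply: card_set_seq; exact: undup_uniq.
set k := count _ _ in kn.
have k0 : (0 < k)%N by case: k kn.
apply/eqP; rewrite -(eqn_pmul2l k0) kn; apply/eqP.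
have -> : 648%N = size (map f Gs) by rewrite size_map size_Gs.
transitivity (\sum_(L <- U) k)%N; last first.
  by rewrite big_const_seq count_predT iter_addn_0 mulnC.
rewrite -[LHS]sum_count_undup -/U big_seq [RHS]big_seq; apply: eq_bigr => L.
rewrite mem_undup => /mapP[g gG ->]; rewrite count_map.
rewrite -(permP (perm_Gs gG)) count_map; apply: eq_in_count => h hG /=.
have u := Gs_unit gG; rewrite /f -mulmxA eq_line ?mulmx_eq0 ?Gs_unit //.
exact: mem_line_unit.
Qed.

Lemma mem_endo_img g H v : g \in unitmx ->
  (v \in (endo g @: H)%VS) = (invmx g *m v \in H).
Proof.
move=> gu; apply/memv_imgP/idP => [[u uH ->]|h]; first by rewrite endoE mulKmx.
by exists (invmx g *m v); rewrite // endoE mulKVmx.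
Qed.

Lemma dim_endo_img g H : g \in unitmx -> \dim (endo g @: H) = \dim H.
Proof.
move=> gu; apply: limg_dim_eq; apply/eqP; rewrite -subv0; apply/subvP => v.
rewrite memv_cap memv_ker endoE mulmx_eq0 // => /andP[_ /eqP->]; exact: mem0v.
Qed.

Lemma endo_imgK g H : g \in unitmx -> (endo (invmx g) @: (endo g @: H))%VS = H.
Proof.
move=> gu; apply/vspaceP => v; rewrite !mem_endo_img ?unitmx_inv // invmxK.
by rewrite mulKmx.
Qed.

(** Taking images under g is a bijection between the planes through L and those through its image,
    so plane counts need only be computed for one line of each orbit. *)
Lemma card_through (P : set {vspace V}) g L : g \in Gs ->
  (forall h H, h \in Gs -> P H -> P (endo h @: H)%VS) ->
  ([set H | P H /\ (endo g @: L <= H)%VS] #= [set H | P H /\ (L <= H)%VS])%card.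
Proof.
move=> gG PG; have gu := Gs_unit gG.
have -> : [set H | P H /\ (endo g @: L <= H)%VS] =
    [set (endo g @: H)%VS | H in [set H | P H /\ (L <= H)%VS]].
  apply/seteqP; split => [H [PH LH]|_ [H [PH LH] <-]]; last first.
    by split; [apply: PG | apply: limgS].
  exists (endo (invmx g) @: H)%VS; last by rewrite -{1}(invmxK g) endo_imgK ?unitmx_inv.
  split; first exact: PG (Gs_invmx gG) PH.
  by rewrite -(endo_imgK L gu); apply: limgS.
apply: inj_card_eq => H K _ _ e.
by rewrite -(endo_imgK H gu) e endo_imgK.
Qed.

Lemma Gs_conj g h : g \in Gs -> h \in Gs -> h *m g *m invmx h \in Gs.
Proof. by move=> gG hG; exact: Gs_mul (Gs_mul hG gG) (Gs_invmx hG). Qed.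

Lemma reflection_plane_img h H : h \in Gs -> reflection_plane H ->
  reflection_plane (endo h @: H)%VS.
Proof.
move=> hG [dH [g gG [g1 gH]]]; have hu := Gs_unit hG.
split; first by rewrite dim_endo_img.
exists (h *m g *m invmx h).
  exact/G25P/(Gs_conj _ hG)/G25P.
split.
  apply: contra g1 => /eqP e; apply/eqP.
  by rewrite -(mulKmx hu g) -[h *m g](mulmxKV hu) e mul1mx mulVmx.
by move=> v; rewrite mem_endo_img // => /gH e; rewrite -!mulmxA e mulKVmx.
Qed.

Lemma regular_vector_img h v : h \in Gs -> regular_vector v -> regular_vector (h *m v).
Proof.
move=> hG vreg H rH; have := vreg _ (reflection_plane_img (Gs_invmx hG) rH).
by rewrite (mem_endo_img _ _ (Gs_unit (Gs_invmx hG))) invmxK.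
Qed.

Lemma proper_plane_img h H : h \in Gs -> proper_plane H ->
  proper_plane (endo h @: H)%VS.
Proof.
move=> hG [[v vH vreg] [g [z [gG z6 HE]]]]; have hu := Gs_unit hG; split.
  exists (h *m v); last exact: regular_vector_img.
  by rewrite mem_endo_img // mulKmx.
exists (h *m g *m invmx h), z; split; first exact/G25P/(Gs_conj _ hG)/G25P.
  exact: z6.
apply/vspaceP => u; rewrite mem_endo_img // HE !mem_leigenspace -!mulmxA.
rewrite -(inj_eq (can_inj (mulKmx hu))) -scalemxAr mulKVmx //.
Qed.

Lemma card_forms_through s x y z :
  all (fun l => ~~ vec0b l) s -> pairwise (fun u v => ~~ par u v) s ->
  ([set H | H \in map ehyp s /\ (<[vec3 x y z]> <= H)%VS] #=
    `I_(count (fun l => @elin R l x y z == 0%R) s))%card.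
Proof.
move=> s0 sp; have us := @uniq_ehyp R s s0 sp.
set P := (X in (X #= _)%card).
have -> : P = [set` [seq H <- map ehyp s | (<[vec3 x y z]> <= H)%VS]].
  by apply/seteqP; split => H; rewrite /P /= mem_filter; [case=> -> ->|case/andP].
have -> : count (fun l => @elin R l x y z == 0) s =
    size [seq H <- map ehyp s | (<[vec3 x y z]> <= H)%VS].
  by rewrite size_filter count_map; apply: eq_count => l /=; rewrite -memvE mem_ehyp.
by apply: card_set_seq; apply: filter_uniq.
Qed.

Lemma orbit_type x y z n r p (v := vec3 x y z) : v != 0 ->
  (count (fun g => g *m v \in <[v]>%VS) Gs * n = 648)%N ->
  count (fun l => @elin R l x y z == 0) refl_forms = r ->
  count (fun l => @elin R l x y z == 0) proper_forms = p ->
  line_orbits_of n r p (line_orbit <[v]>%VS).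
Proof.
move=> v0 kn cr cp; split.
- by exists <[v]>%VS => //; apply/lineP; exists v.
- exact: card_line_orbit kn.
- move=> _ [g /G25P gG <-]; split.
    apply: (card_eq_trans (card_through _ gG reflection_plane_img)).
    have := @card_forms_through refl_forms x y z refl_forms_neq0 refl_forms_pairwise.
    rewrite cr; congr (_ #= _)%card; apply/seteqP; split=> H [HP LH]; split => //;
      exact/reflection_planeP.
  apply: (card_eq_trans (card_through _ gG proper_plane_img)).
  have := @card_forms_through proper_forms x y z proper_forms_neq0 proper_forms_pairwise.
  rewrite cp; congr (_ #= _)%card; apply/seteqP; split=> H [HP LH]; split => //;
    exact/proper_planeP.
Qed.

Definition fixes (A : emat) (x y z : C) : bool :=
  let p := elin (r1 A) x y z in
  let q := elin (r2 A) x y z in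
  let r := elin (r3 A) x y z in
  [&& y * r == z * q, z * p == x * r & x * q == y * p].

Lemma fixesE A x y z : vec3 x y z != 0 ->
  fixes A x y z = (gC A *m vec3 x y z \in <[vec3 x y z]>%VS).
Proof.
move=> v0; rewrite /fixes -mem_line_vec3 // -evmM evm_gC -scalemxAl.
by rewrite rpredZeq (negPf (ev_theta_neq0 R)).
Qed.

Lemma count_fixes x y z : vec3 x y z != 0 ->
  count (fun g => g *m vec3 x y z \in <[vec3 x y z]>%VS) Gs =
  count (fun A => fixes A x y z) Gl.
Proof. by move=> v0; rewrite count_map; apply: eq_count => A /=; rewrite fixesE. Qed.

End Orbits.

(** * Stabilizers of lines *)

(** The polynomial al * t + be is constant or has its root in [roots]; outside [roots] it vanishes
    only if it is identically zero. *)
Definition lin_ok (roots : seq eis) (al be : eis) : bool :=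
  if eis0b al then true
  else hasb (fun r => eis0b (eadd (emul al r) be)) roots.

(* [q] stands for the polynomial [e1 q * t^2 + e2 q * t + e3 q]. *)
Definition fam_ok roots (quads : seq evec) (lq : (eis * eis) * evec) : bool :=
  let: ((al, be), q) := lq in
  if lin_ok roots al be then
    if eis0b al && eis0b be then if vec0b q then true else hasb (par q) quads
    else true
  else false.
(** The expected answer at a parameter outside the exceptional roots, when [quads] lists the
    exceptional quadratics that vanish there. *)
Definition fam_fixes (quads : seq evec) (lq : (eis * eis) * evec) : bool :=
  let: ((al, be), q) := lq in
  if eis0b al && eis0b be then if vec0b q then true else hasb (par q) quads
  else false.

Definition eis2 : eis := (Zpos 2, Z0).
(* The element A fixes the line [t : 1 : 1] if and only if t is a root of both
   polynomials; [famH] is the analogue for [t : 1 : 0]. *)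
Definition famE (A : emat) : (eis * eis) * evec :=
  let: EMat p q r := A in
  ((esub (e1 q) (e1 r), esub (eadd (e2 q) (e3 q)) (eadd (e2 r) (e3 r))),
   EVec (eopp (e1 q)) (esub (e1 p) (eadd (e2 q) (e3 q))) (eadd (e2 p) (e3 p))).
Definition rootsE : seq eis :=
  eis0 :: eunits ++ [seq eopp (emul eis2 w) | w <- eunits].
(** The roots are w * (1 + sqrt 3) and w * (1 - sqrt 3), outside Q(omega). *)
Definition quadE0 (w : eis) : evec :=
  EVec eis1 (eopp (emul eis2 w)) (eopp (emul eis2 (emul w w))).
(** These split over Q(omega) with roots in [rootsE]: t ^ 2 + w * t - 2 * w ^ 2 = (t - w) * (t + 2 *
    w). *)
Definition quadsE1 : seq evec :=
  EVec eis0 eis1 eis0 :: [seq EVec eis1 w (eopp (emul eis2 (emul w w))) | w <- eunits].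
Definition quadsE : seq evec := quadsE1 ++ [seq quadE0 w | w <- eunits].

Definition famH (A : emat) : (eis * eis) * evec :=
  let: EMat p q r := A in
  ((e1 r, e2 r), EVec (eopp (e1 q)) (esub (e1 p) (e2 q)) (e2 p)).
Definition rootsH : seq eis := eis0 :: eunits ++ [seq eopp w | w <- eunits].
(** For a cube root of unity w, the roots of t ^ 2 - w are w ^ 2 and - w ^ 2, which are in
    [rootsH]. *)
Definition quadsH : seq evec :=
  EVec eis0 eis1 eis0 :: [seq EVec eis1 eis0 (eopp w) | w <- eunits].

Lemma famE_check : all (fun A => fam_ok rootsE quadsE (famE A)) Gl.
Proof. by vm_compute. Qed.
(** The generic stabilizer of [t : 1 : 1] consists of the scalars and their products with the
    negative of the transposition (y z). *)
Lemma famE_count : count (fun A => fam_fixes [::] (famE A)) Gl = 6%N.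
Proof. by vm_compute. Qed.
Lemma famE_count0 : count (fun A => fam_fixes [:: quadE0 eis1] (famE A)) Gl = 12%N.
Proof. by vm_compute. Qed.
Lemma famE_forms : all (fun l => lin_ok rootsE (e1 l) (eadd (e2 l) (e3 l)))
  (refl_forms ++ proper_forms).
Proof. by vm_compute. Qed.
Lemma famH_check : all (fun A => fam_ok rootsH quadsH (famH A)) Gl.
Proof. by vm_compute. Qed.
(** The generic stabilizer of [t : 1 : 0] is generated by the scalars and the reflection R1 in the
    plane z = 0. *)
Lemma famH_count : count (fun A => fam_fixes [::] (famH A)) Gl = 9%N.
Proof. by vm_compute. Qed.
Lemma famH_forms : all (fun l => lin_ok rootsH (e1 l) (e2 l))
  (refl_forms ++ proper_forms).
Proof. by vm_compute. Qed.

(* The norm over Q(omega) of [al * t + be] when [t ^ 2 = 2 * t + 2]. *)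
Definition norm2 (al be : eis) : eis :=
  esub (eadd (emul be be) (emul eis2 (emul al be))) (emul eis2 (emul al al)).
Lemma sqrt3_roots : all (fun r => ~~ eis0b (norm2 eis1 (eopp r))) rootsE.
Proof. by vm_compute. Qed.
(** Each quadratic is first reduced modulo t ^ 2 = 2 * t + 2 to a linear polynomial in t. *)
Lemma sqrt3_quads : all (fun q =>
    ~~ eis0b (norm2 (eadd (emul eis2 (e1 q)) (e2 q)) (eadd (emul eis2 (e1 q)) (e3 q))))
  (quadsE1 ++ [:: quadE0 eisw; quadE0 eisw2]).
Proof. by vm_compute. Qed.
(* Some element maps the line of (2 - t, 1, 1) to that of (t, 1, 1) when
   t ^ 2 = 2 * t + 2, so the two roots give the same orbit. *)
Lemma sqrt3_conj : hasb (fun A => let: EMat p q r := A in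
  let: ((al, be), _) := famE A in
  if eis0b al && eis0b be then
    eis0b (eadd (emul eis2 (e1 p)) (eadd (eadd (e2 p) (e3 p)) (emul eis2 (e1 q)))) &&
    eis0b (eadd (e1 p) (eadd (e2 q) (e3 q)))
  else false) Gl.
Proof. by vm_compute. Qed.

(* [cubic c] is the norm of [e1 c * l ^ 2 + e2 c * l + e3 c] when [l ^ 3 = omega]. *)
Definition cubic (c : evec) : eis :=
  let: EVec c b a := c in
  let cube x := emul x (emul x x) in
  esub (eadd (cube a) (eadd (emul eisw (cube b)) (emul eisw2 (cube c))))
       (emul (emul (eadd eis2 eis1) eisw) (emul a (emul b c))).
(* The coefficients of l * r - q, where r and q are evaluated at (l ^ 2, l, 1)
   and l ^ 3 = omega. *)
Definition lam_diff (r q : evec) : evec :=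
  EVec (esub (e2 r) (e1 q)) (esub (e3 r) (e2 q)) (esub (emul eisw (e1 r)) (e3 q)).
Definition cubic_ok (c : evec) : bool := if vec0b c then true else ~~ eis0b (cubic c).
(** The image (p, q, r) of (l ^ 2, l, 1) is proportional to it exactly when q = l * r and p = l * q.
    Each difference either has zero coefficients or has nonzero norm, so the stabilizer is the same
    for the three cube roots l of omega. *)
Lemma cubic_check : all (fun A => cubic_ok (lam_diff (r3 A) (r2 A)) &&
  cubic_ok (lam_diff (r2 A) (r1 A))) Gl.
Proof. by vm_compute. Qed.
Lemma cubic_count : count (fun A => vec0b (lam_diff (r3 A) (r2 A)) &&
  vec0b (lam_diff (r2 A) (r1 A))) Gl = 9%N.
Proof. by vm_compute. Qed.
Lemma cubic_forms : all (fun l => ~~ eis0b (cubic l)) (refl_forms ++ proper_forms).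
Proof. by vm_compute. Qed.

Definition pfixes (u : evec) (A : emat) : bool := par u (mapply A u).
Definition pt12 := EVec eis1 eis0 eis0.
Definition pt9 := EVec eis0 eis1 (eopp eis1).
Definition pt36 := EVec eis0 eis1 eis1.
Definition pcounts (u : evec) :=
  (count (pfixes u) Gl, count (fun l => eis0b (dot l u)) refl_forms,
   count (fun l => eis0b (dot l u)) proper_forms).
Lemma pt12_counts : pcounts pt12 = (54, 2, 3)%N. Proof. by vm_compute. Qed.
Lemma pt9_counts : pcounts pt9 = (72, 4, 0)%N. Proof. by vm_compute. Qed.
Lemma pt36_counts : pcounts pt36 = (18, 1, 1)%N. Proof. by vm_compute. Qed.
Definition conj_check u v := hasb (fun A => par v (mapply A u)) Gl.
(** This and the next two lemmas send the points of the two families with t in [rootsE] or [rootsH]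
    to three representatives; t = 0 in [rootsE] gives [pt36] itself. *)
Lemma pt12_conj : all (conj_check^~ pt12)
  (EVec eis0 eis1 eis0 :: [seq EVec w eis1 eis1 | w <- eunits]).
Proof. by vm_compute. Qed.
Lemma pt9_conj : all (conj_check^~ pt9) [seq EVec (eopp w) eis1 eis0 | w <- eunits].
Proof. by vm_compute. Qed.
Lemma pt36_conj : all (conj_check^~ pt36)
  ([seq EVec w eis1 eis0 | w <- eunits] ++
   [seq EVec (eopp (emul eis2 w)) eis1 eis1 | w <- eunits]).
Proof. by vm_compute. Qed.

Lemma diag_check : all (fun a => all (fun b => all (fun c =>
  hasb (meq (ediag a b c)) Gl) eunits) eunits) eunits.
Proof. by vm_compute. Qed.
Definition gswap := mmap (emul (eopp eistheta))
  (EMat (EVec eis0 eis1 eis0) (EVec eis1 eis0 eis0) (EVec eis0 eis0 eis1)).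
Lemma swap_check : hasb (meq gswap) Gl. Proof. by vm_compute. Qed.

(** If the third row of A is proportional to l, then A maps the plane of l to z = 0. Similarly the
    difference of rows in the next lemma yields the plane y = z. *)
Lemma refl_forms_conj : all (fun l => hasb (fun A => par l (r3 A)) Gl) refl_forms.
Proof. by vm_compute. Qed.
Lemma proper_forms_conj :
  all (fun l => hasb (fun A => par l (vsub (r2 A) (r3 A))) Gl) proper_forms.
Proof. by vm_compute. Qed.

(** The last one has cube omega, so its eigenvalues are the l with l ^ 3 = omega. *)
Definition class_reps : seq emat :=
  [:: gR1; ediag eis1 eisw eisw2;
      mmap (emul (eopp eistheta))
        (EMat (EVec eis1 eis0 eis0) (EVec eis0 eis0 eis1) (EVec eis0 eis1 eis0));
      mmap (emul eistheta)
        (EMat (EVec eis0 eis1 eis0) (EVec eis0 eis0 eisw) (EVec eis1 eis0 eis0))].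
(** Conjugating by these 72 elements already reaches enough conjugates for [fix_check], at a ninth
    of the cost. *)
Definition short_Gl : seq emat := [seq gword u | u <- short_words].
Definition conjugates : seq emat :=
  [seq mmul (mmul h g) (madj h) | h <- short_Gl, g <- class_reps].
Definition scalarb (A : emat) : bool := hasb (fun w => meq A (mmap (emul w) g1)) eunits.
Lemma scalar_count : count scalarb Gl = 3%N. Proof. by vm_compute. Qed.
Definition eis3 : eis := (Zpos 3, Z0).
(* A power of g with exponent at most 3 is a scalar multiple of a conjugate of
   one of [class_reps]. The powers of theta and the factor 3 compensate for the
   scaling of the representatives: [conjugates] contains 3 * theta * g. *)
Definition fix_check (A : emat) : bool :=
  if scalarb A then true else
  let A2 := mmul A A in let A3 := mmul A2 A in
  hasb (fun w => let c := emul eis3 w in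
    let B := mmap (emul c) A in
    if hasb (meq B) conjugates then true else
    let B := mmap (emul c) A2 in
    if hasb (fun M => meq B (mmap (emul eistheta) M)) conjugates then true else
    let B := mmap (emul c) A3 in
    hasb (fun M => meq B (mmap (emul (emul eistheta eistheta)) M)) conjugates) eunits.
Lemma fix_check_true : all fix_check Gl. Proof. by vm_compute. Qed.
(** The group is unitary and theta has squared modulus 3; the adjoint thus replaces the inverse in
    [conjugates]. *)
Lemma short_adj : all (fun h => meq (mmul (madj h) h) (mscal eis3)) short_Gl.
Proof. by vm_compute. Qed.

(** * Orbit sizes and plane counts of the normal forms *)

Section Types.
Variable R : realType.
Local Notation C := R[i].
Local Notation V := 'cV[C]_3.
Local Notation w := (@omega R).
Local Notation ev := (@ev R).
Local Notation elin := (@elin R).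
Local Notation orbit x y z := (line_orbit <[vec3 x%R y%R z%R]>%VS).

Lemma lin_okP roots al be t : lin_ok roots al be ->
  (forall r, r \in roots -> t != ev r) ->
  (ev al * t + ev be == 0) = eis0b al && eis0b be.
Proof.
rewrite /lin_ok; case: ifP => [al0 _ _|al0].
  by move: al0; rewrite -(ev_eq0 R) => /eqP->; rewrite mul0r add0r ev_eq0.
rewrite hasbE => /hasP[r rr]; rewrite -(ev_eq0 R) evD evM => /eqP e tr.
apply: contraNF (tr r rr) => /eqP h; rewrite -subr_eq0.
have : ev al * (t - ev r) == 0.
  by apply/eqP; transitivity (ev al * t + ev be - (ev al * ev r + ev be));
    [ring | rewrite h e subrr].
by rewrite mulf_eq0 ev_eq0 al0.
Qed.

Lemma fam_okP roots quads quads0 al be q t : fam_ok roots quads ((al, be), q) ->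
  (forall r, r \in roots -> t != ev r) ->
  (forall k, k \in quads -> k \in quads0 \/ elin k (t ^+ 2) t 1 != 0) ->
  (forall k, k \in quads0 -> ~~ vec0b k /\ elin k (t ^+ 2) t 1 = 0) ->
  (ev al * t + ev be == 0) && (elin q (t ^+ 2) t 1 == 0) =
  fam_fixes quads0 ((al, be), q).
Proof.
rewrite /fam_ok /fam_fixes; case: ifP => // lok + tr qs qs0.
rewrite (lin_okP lok tr); case: ifP => //= _; case: ifP => [q0 _|/negbT q0].
  apply/eqP; move: q0; rewrite (vec0bE R) vec3_eq0 => /and3P[/eqP a /eqP b /eqP c].
  by rewrite !elinE a b c !mul0r !addr0.
rewrite !hasbE => /hasP[k kq qk]; apply/eqP/hasP => [e|[j /qs0[j0 je] qj]].
  case: (qs k kq) => [k0|]; first by exists k.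
  by rewrite (parP qk e q0) eqxx.
by apply: parP je j0; rewrite par_sym.
Qed.

Lemma famEP A t : fixes A t 1 1 =
  let: ((al, be), q) := famE A in
  (ev al * t + ev be == 0) && (elin q (t ^+ 2) t 1 == 0).
Proof.
case: A => p q r; rewrite /fixes /= !elinE /= !(evB, evD, evN) !mul1r.
set P := ev (e1 p) * t + _ + _; set Q := ev (e1 q) * t + _ + _.
set S := ev (e1 r) * t + _ + _.
have -> : (ev (e1 q) - ev (e1 r)) * t +
    (ev (e2 q) + ev (e3 q) - (ev (e2 r) + ev (e3 r))) = Q - S.
  by rewrite /Q /S; ring.
have -> : - ev (e1 q) * t ^+ 2 + (ev (e1 p) - (ev (e2 q) + ev (e3 q))) * t +
    (ev (e2 p) + ev (e3 p)) * 1 = P - t * Q by rewrite /P /Q; ring.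
rewrite !subr_eq0; apply/and3P/andP => [[/eqP-> _ /eqP->]|[/eqP-> /eqP->]] //.
Qed.

Lemma famHP A t : fixes A t 1 0 =
  let: ((al, be), q) := famH A in
  (ev al * t + ev be == 0) && (elin q (t ^+ 2) t 1 == 0).
Proof.
case: A => p q r; rewrite /fixes /= !elinE /= !(evB, evN) !mul1r !mul0r !mulr0 !addr0.
rewrite !mulr1.
set P := ev (e1 p) * t + _; set Q := ev (e1 q) * t + _.
set S := ev (e1 r) * t + _.
have -> : - ev (e1 q) * t ^+ 2 + (ev (e1 p) - ev (e2 q)) * t + ev (e2 p) =
  P - t * Q by rewrite /P /Q; ring.
rewrite subr_eq0; apply/and3P/andP => [[/eqP-> _ /eqP->]|[/eqP-> /eqP->]] //.
by rewrite !mulr0 !eqxx.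
Qed.

Definition good (roots : seq eis) (quads : seq evec) (t : C) : bool :=
  all (fun r => t != ev r) roots && all (fun k => elin k (t ^+ 2) t 1 != 0) quads.

Lemma vec3_neq0 x z : vec3 x 1 z != 0 :> V.
Proof. by rewrite vec3_eq0 oner_eq0 andbF. Qed.

Lemma count_formsE s t : all (fun l => lin_ok rootsE (e1 l) (eadd (e2 l) (e3 l))) s ->
  (forall r, r \in rootsE -> t != ev r) ->
  count (fun l => elin l t 1 1 == 0) s =
  count (fun l => eis0b (e1 l) && eis0b (eadd (e2 l) (e3 l))) s.
Proof.
move=> /allP sok tr; apply: eq_in_count => l /sok /lin_okP/(_ tr) <-.
by rewrite !elinE evD !mulr1 -addrA.
Qed.

Lemma count_formsH s t : all (fun l => lin_ok rootsH (e1 l) (e2 l)) s ->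
  (forall r, r \in rootsH -> t != ev r) ->
  count (fun l => elin l t 1 0 == 0) s =
  count (fun l => eis0b (e1 l) && eis0b (e2 l)) s.
Proof.
move=> /allP sok tr; apply: eq_in_count => l /sok /lin_okP/(_ tr) <-.
by rewrite !elinE mulr1 mulr0 addr0.
Qed.

(** [quads0] is empty for a generic t and consists of [quadE0 eis1] for t = 1 + sqrt 3 or 1 - sqrt
    3. *)
Lemma typeE quads0 t k n : (forall r, r \in rootsE -> t != ev r) ->
  (forall k, k \in quadsE -> k \in quads0 \/ elin k (t ^+ 2) t 1 != 0) ->
  (forall k, k \in quads0 -> ~~ vec0b k /\ elin k (t ^+ 2) t 1 = 0) ->
  count (fun A => fam_fixes quads0 (famE A)) Gl = k -> (k * n = 648)%N ->
  line_orbits_of n 0 1 (orbit t 1 1).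
Proof.
move=> tr qs qs0 ck kn; have := famE_forms; rewrite all_cat => /andP[f1 f2].
apply: orbit_type; first exact: vec3_neq0.
- rewrite count_fixes ?vec3_neq0 // -kn -ck; congr (_ * _)%N.
  apply: eq_in_count => A /(allP famE_check); rewrite famEP.
  by case: (famE A) => [[al be] q] ok; rewrite (fam_okP ok tr qs qs0).
- by rewrite (count_formsE f1 tr).
- by rewrite (count_formsE f2 tr).
Qed.

Lemma type108 t : good rootsE quadsE t -> line_orbits_of 108 0 1 (orbit t 1 1).
Proof.
case/andP=> /allP tr /allP qs.
by apply: (@typeE [::] t 6) famE_count _ => // k /qs; right.
Qed.

Lemma sqrt3_neq t r : t ^+ 2 = 2 * t + 2 -> ~~ eis0b (norm2 eis1 (eopp r)) -> t != ev r.
Proof.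
move=> t2; rewrite -(ev_eq0 R); apply: contra => /eqP tr.
rewrite /norm2 !(evD, evB, evM, evN) -tr ev1 /eis2; have -> : ev (Zpos 2, Z0) = 2.
  by rewrite -[(_, _)]/(eadd eis1 eis1) evD ev1 -natr1.
by apply/eqP; transitivity (t ^+ 2 - 2 * t - 2); [ring | rewrite t2; ring].
Qed.

Lemma ev2 : ev eis2 = 2.
Proof. by rewrite -[eis2]/(eadd eis1 eis1) evD ev1. Qed.

Lemma sqrt3_quad_neq0 t q : t ^+ 2 = 2 * t + 2 ->
  ~~ eis0b (norm2 (eadd (emul eis2 (e1 q)) (e2 q)) (eadd (emul eis2 (e1 q)) (e3 q))) ->
  elin q (t ^+ 2) t 1 != 0.
Proof.
move=> t2; rewrite -(ev_eq0 R); apply: contra => /eqP.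
rewrite !elinE t2 /norm2 !(evD, evB, evM, evN) ev2 mulr1.
set a := ev (e1 q); set b := ev (e2 q); set c := ev (e3 q) => h.
have e : (2 * a + b) * t = - (2 * a + c).
  by apply/eqP; rewrite -subr_eq0 opprK -h; apply/eqP; ring.
(* The norm is written as a combination of t ^ 2 - 2 * t - 2 and of the linear polynomial that
   vanishes at t. *)
apply/eqP; transitivity ((2 * a + b) ^+ 2 * (t ^+ 2 - (2 * t + 2)) + (2 * a + c) ^+ 2
   - ((2 * a + b) * t) ^+ 2 + 2 * (2 * a + b) * ((2 * a + c) + (2 * a + b) * t)).
  by ring.
by rewrite t2 e; ring.
Qed.

Lemma type54 (t : C) : t ^+ 2 = 2 * t + 2 -> line_orbits_of 54 0 1 (orbit t 1 1).
Proof.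
move=> t2; apply: (@typeE [:: quadE0 eis1] t 12) famE_count0 _ => //.
- by move=> r rr; apply: sqrt3_neq => //; apply: (allP sqrt3_roots).
- move=> k; rewrite /quadsE mem_cat => /orP[k1|].
    right; apply: sqrt3_quad_neq0 => //; apply: (allP sqrt3_quads).
    by rewrite mem_cat k1.
  rewrite inE => /orP[/eqP->|k1]; first by left; rewrite inE.
  right; apply: sqrt3_quad_neq0 => //; apply: (allP sqrt3_quads).
  by rewrite mem_cat k1 orbT.
- move=> k; rewrite inE => /eqP->; split=> //.
  by rewrite !elinE /= !evN !evM ev1 ev2 t2; ring.
Qed.

Lemma type72_1 t : good rootsH quadsH t -> line_orbits_of 72 1 0 (orbit t 1 0).
Proof.
case/andP=> /allP tr /allP qs; have := famH_forms; rewrite all_cat => /andP[f1 f2].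
apply: orbit_type; first exact: vec3_neq0.
- rewrite count_fixes ?vec3_neq0 //; suff -> : count (fun A => fixes A t 1 0) Gl = 9%N by [].
  rewrite -famH_count.
  apply: eq_in_count => A /(allP famH_check); rewrite famHP.
  case: (famH A) => [[al be] q] ok; rewrite (@fam_okP _ _ [::] _ _ _ _ ok tr) //.
  by move=> k /qs; right.
- by rewrite (count_formsH f1 tr).
- by rewrite (count_formsH f2 tr).
Qed.

Lemma cubicP c (l : C) : l ^+ 3 = w -> ~~ eis0b (cubic c) ->
  elin c (l ^+ 2) l 1 != 0.
Proof.
move=> l3; rewrite -(ev_eq0 R); apply: contra => /eqP h; case: c h => c b a.
rewrite !elinE /cubic /= !(evB, evD, evM) evw evw2 ev2 ev1.
move: (ev a) (ev b) (ev c) => {}a {}b {}c h.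
(* The factorization of X ^ 3 + Y ^ 3 + Z ^ 3 - 3 * X * Y * Z for X = a, Y = b * l, Z = c * l ^
   2. *)
apply/eqP; transitivity ((c * l ^+ 2 + b * l + a * 1) *
   (a ^+ 2 + b ^+ 2 * l ^+ 2 + c ^+ 2 * l ^+ 4 - a * b * l - a * c * l ^+ 2
     - b * c * l ^+ 3)); last by rewrite h mul0r.
have l4 : l ^+ 4 = w * l by rewrite exprSr l3.
by rewrite l4 l3; ring: l3.
Qed.

(** In the order (l ^ 2, l, 1) a linear form becomes a polynomial in l; [orbit_swap] restores the
    order of the theorem. *)
Lemma type72_0 (l : C) : l ^+ 3 = w -> line_orbits_of 72 0 0 (orbit (l ^+ 2) l 1).
Proof.
move=> l3; have := cubic_forms; rewrite all_cat => /andP[f1 f2].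
have v0 : vec3 (l ^+ 2) l 1 != 0 by rewrite vec3_eq0 oner_eq0 !andbF.
have cok c : cubic_ok c -> (elin c (l ^+ 2) l 1 == 0) = vec0b c.
  rewrite /cubic_ok; case: ifP => [+ _|_ /(cubicP l3)/negPf //].
  rewrite (vec0bE R) vec3_eq0 !elinE => /and3P[/eqP-> /eqP-> /eqP->].
  by rewrite !mul0r !addr0 eqxx.
have l0 : l != 0.
  by apply/eqP => e; move: (omegaX3 R); rewrite -l3 e !expr0n /= => /eqP;
    rewrite eq_sym oner_eq0.
have sh r q : elin (lam_diff r q) (l ^+ 2) l 1 =
    l * elin r (l ^+ 2) l 1 - elin q (l ^+ 2) l 1.
  by rewrite !elinE /= !evB evM evw; ring: l3.
apply: orbit_type => //.
- rewrite count_fixes //.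
  suff -> : count (fun A => fixes A (l ^+ 2) l 1) Gl = 9%N by [].
  rewrite -cubic_count.
  apply: eq_in_count => A /(allP cubic_check)/andP[/cok <- /cok <-].
  rewrite !sh /fixes !subr_eq0 !mul1r; set p := elin (r1 A) _ _ _.
  set q := elin (r2 A) _ _ _; set r := elin (r3 A) _ _ _.
  apply/and3P/andP => [[e1 e2 e3]|[/eqP<- /eqP<-]]; split=> //.
  - apply/eqP/(mulfI l0); rewrite -(eqP e3); ring.
  - by apply/eqP; ring.
  - by apply/eqP; ring.
- by apply/eqP; rewrite -leqn0 leqNgt -has_count; apply/hasPn => k /(allP f1)/(cubicP l3).
- by apply/eqP; rewrite -leqn0 leqNgt -has_count; apply/hasPn => k /(allP f2)/(cubicP l3).
Qed.

Lemma pt_type u n k r p : pcounts u = (k, r, p) -> (k * n = 648)%N -> ~~ vec0b u ->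
  line_orbits_of n r p (line_orbit <[evec_col R u]>%VS).
Proof.
move=> pc kn u0.
have ck : count (pfixes u) Gl = k := congr1 (fun c => c.1.1) pc.
have cr : count (fun l => eis0b (dot l u)) refl_forms = r := congr1 (fun c => c.1.2) pc.
have cp : count (fun l => eis0b (dot l u)) proper_forms = p := congr1 (fun c => c.2) pc.
have v0 : evec_col R u != 0 by rewrite -(vec0bE R).
apply: orbit_type => //.
- rewrite count_fixes // -kn -ck; congr (_ * _)%N; apply: eq_count => A.
  by rewrite /pfixes /par (vec0bE R) vec3_eq0 /fixes !evB !evM !ev_dot !subr_eq0.
- by rewrite -cr; apply: eq_in_count => l _; rewrite -ev_dot ev_eq0.
- by rewrite -cp; apply: eq_in_count => l _; rewrite -ev_dot ev_eq0.
Qed.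

Lemma type12 : line_orbits_of 12 2 3 (line_orbit <[evec_col R pt12]>%VS).
Proof. exact: (@pt_type pt12 12 _ _ _ pt12_counts (erefl _) isT). Qed.
Lemma type9 : line_orbits_of 9 4 0 (line_orbit <[evec_col R pt9]>%VS).
Proof. exact: (@pt_type pt9 9 _ _ _ pt9_counts (erefl _) isT). Qed.
Lemma type36 : line_orbits_of 36 1 1 (line_orbit <[evec_col R pt36]>%VS).
Proof. exact: (@pt_type pt36 36 _ _ _ pt36_counts (erefl _) isT). Qed.

Lemma type216 x y z : vec3 x y z != 0 ->
  {in refl_forms ++ proper_forms, forall l, elin l x y z != 0} ->
  {in Gl, forall A, fixes A x y z -> scalarb A} ->
  line_orbits_of 216 0 0 (orbit x y z).
Proof.
move=> v0 f fs; apply: orbit_type => //.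
- rewrite count_fixes //; suff -> : count (fun A => fixes A x y z) Gl = 3%N by [].
  rewrite -scalar_count.
  apply: eq_in_count => A AG; apply/idP/idP; first exact: fs.
  rewrite /scalarb hasbE => /hasP[c _ /(meqP R) e].
  rewrite fixesE // /gC e evm_scal evm_gC gC1 !scalerA scalemx1.
  by rewrite mul_scalar_mx memvZ ?memv_line.
- by apply/eqP; rewrite -leqn0 leqNgt -has_count; apply/hasPn => l lF; apply: f;
    rewrite mem_cat lF.
- by apply/eqP; rewrite -leqn0 leqNgt -has_count; apply/hasPn => l lF; apply: f;
    rewrite mem_cat lF orbT.
Qed.

End Types.

(** * Classification of the orbits *)

Section NormalForms.
Variable R : realType.
Local Notation C := R[i].
Local Notation V := 'cV[C]_3.
Local Notation w := (@omega R).
Local Notation ev := (@ev R).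
Local Notation gC := (@gC R).
Local Notation Gs := (@Gs R).
Local Notation elin := (@elin R).
Local Notation orbit x y z := (line_orbit <[vec3 x%R y%R z%R]>%VS).
Local Notation eorbit u := (line_orbit <[evec_col R u]>%VS).

Lemma orbit_img g (v : V) : g \in Gs -> line_orbit <[g *m v]>%VS = line_orbit <[v]>%VS.
Proof.
move=> gG; rewrite !line_orbitE; apply/seteqP; split => _ [h hG <-] /=.
  by exists (h *m g); [exact: Gs_mul hG gG | rewrite mulmxA].
exists (h *m invmx g); first exact: Gs_mul hG (Gs_invmx gG).
by rewrite -mulmxA mulKmx ?(Gs_unit gG).
Qed.

Lemma orbit_line (u v : V) : u != 0 -> v != 0 -> u \in <[v]>%VS ->
  line_orbit <[u]>%VS = line_orbit <[v]>%VS.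
Proof. by move=> u0 v0 uv; congr line_orbit; apply/eqP; rewrite eq_line. Qed.

Lemma orbit_eq g (u v : V) : g \in Gs -> u != 0 -> v != 0 -> g *m u \in <[v]>%VS ->
  line_orbit <[u]>%VS = line_orbit <[v]>%VS.
Proof.
move=> gG u0 v0 uv; rewrite -(orbit_img u gG); apply: orbit_line => //.
by rewrite mulmx_eq0 ?(Gs_unit gG).
Qed.

Lemma orbit_scale (k x y z : C) : k != 0 -> orbit (k * x) (k * y) (k * z) = orbit x y z.
Proof.
move=> k0; rewrite -scale_vec3; have [->|v0] := eqVneq (vec3 x y z) 0.
  by rewrite scaler0.
by apply: orbit_line; rewrite ?scaler_eq0 ?negb_or ?k0 // memvZ // memv_line.
Qed.

Lemma orbit_diag a b c x y z : a \in eunits -> b \in eunits -> c \in eunits ->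
  orbit (ev a * x) (ev b * y) (ev c * z) = orbit x y z.
Proof.
move=> au bu cu; have := allP (allP (allP diag_check a au) b bu) c cu.
rewrite hasbE => /hasP[A AG /(meqP R) e].
rewrite -(orbit_img (vec3 x y z) (map_f gC AG)) /gC -e -/(gC _) gC_scal evmM !elinE /=.
by rewrite !ev0 !mul0r !addr0 !add0r.
Qed.

Lemma orbit_swap (x y z : C) : orbit y x z = orbit x y z.
Proof.
have := swap_check; rewrite hasbE => /hasP[A AG /(meqP R) e].
rewrite -(orbit_img (vec3 x y z) (map_f gC AG)) /gC -e evm_scal scalerA evN.
rewrite mulrN mulVf ?ev_theta_neq0 // -scalemxAl evmM !elinE /= !ev0 !ev1.
rewrite !mul0r !mul1r !addr0 !add0r scale_vec3 orbit_scale //.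
by rewrite oppr_eq0 oner_eq0.
Qed.

Lemma orbit_conj u v : ~~ vec0b u -> ~~ vec0b v -> conj_check u v -> eorbit u = eorbit v.
Proof.
rewrite !(vec0bE R) /conj_check hasbE => u0 v0 /hasP[A AG].
rewrite /par (vec0bE R) vec3_eq0 !evB !evM !subr_eq0 => h.
apply: (orbit_eq (map_f gC AG) u0 v0); rewrite /gC -scalemxAl memvZ //.
by rewrite evmM mem_line_vec3 // -!ev_dot.
Qed.

Lemma orbit_evm A (v : V) : A \in Gl -> v != 0 ->
  evm R A *m v != 0 /\ line_orbit <[evm R A *m v]>%VS = line_orbit <[v]>%VS.
Proof.
move=> AG v0; have gG := map_f gC AG; have gv0 : gC A *m v != 0.
  by rewrite mulmx_eq0 ?(Gs_unit gG).
have n0 : ev eistheta *: (gC A *m v) != 0.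
  by rewrite scaler_eq0 negb_or ev_theta_neq0.
rewrite evm_gC -scalemxAl; split => //; rewrite -(orbit_img v gG).
by apply: orbit_line; rewrite // memvZ // memv_line.
Qed.

Lemma on_reflection l (x y z : C) : vec3 x y z != 0 -> l \in refl_forms ->
  elin l x y z = 0 ->
  exists x' y', vec3 x' y' 0 != 0 /\ orbit x y z = orbit x' y' 0.
Proof.
move=> v0 lF h; have := allP refl_forms_conj l lF; rewrite hasbE => /hasP[A AG lA].
exists (elin (r1 A) x y z), (elin (r2 A) x y z).
have [] := orbit_evm AG v0; rewrite evmM.
by rewrite (parP lA h (allP refl_forms_neq0 l lF)) => ? ->.
Qed.

Lemma on_proper l (x y z : C) : vec3 x y z != 0 -> l \in proper_forms ->
  elin l x y z = 0 ->
  exists x' y', vec3 x' y' y' != 0 /\ orbit x y z = orbit x' y' y'.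
Proof.
move=> v0 lF h; have := allP proper_forms_conj l lF; rewrite hasbE => /hasP[A AG lA].
exists (elin (r1 A) x y z), (elin (r2 A) x y z).
have e : elin (r3 A) x y z = elin (r2 A) x y z.
  have := parP lA h (allP proper_forms_neq0 l lF); rewrite !elinE /= !evB => h'.
  by apply/eqP; rewrite eq_sym -subr_eq0 -h'; apply/eqP; ring.
by have [] := orbit_evm AG v0; rewrite evmM e => ? ->.
Qed.

Lemma cube_root (u : C) : u ^+ 3 = 1 -> exists2 c, c \in eunits & u = ev c.
Proof.
move=> u3; have : (u - 1) * ((u - w) * (u - w ^+ 2)) == 0.
  by apply/eqP; transitivity (u ^+ 3 - 1); [rewrite omega2E; ring: (omega2E R) | rewrite u3 subrr].
rewrite !mulf_eq0 !subr_eq0 => /or3P[]/eqP->.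
- by exists eis1; rewrite ?ev1 ?inE.
- by exists eisw; rewrite ?evw ?inE.
- by exists eisw2; rewrite ?evw2 ?inE.
Qed.

Lemma eunits_cube c : c \in eunits -> ev c ^+ 3 = 1.
Proof.
rewrite !inE => /or3P[]/eqP->; rewrite ?ev1 ?evw ?evw2 ?expr1n ?omegaX3 //.
by rewrite -exprM mulnC exprM omegaX3 expr1n.
Qed.

(** The quadratics in [quadsH] contribute no exceptional parameter beyond [rootsH]; for [rootsE] the
    only new ones come from [quadE0]. *)
Lemma rootsH_bad t : ~~ good rootsH quadsH t -> exists2 r, r \in rootsH & t = ev r.
Proof.
rewrite /good negb_and => /orP[/allPn[r rr /negPn/eqP]|/allPn[k]]; first by exists r.
rewrite inE => /orP[/eqP->|/mapP[c cu ->]] /negPn/eqP.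
  rewrite !elinE /= !ev0 ev1 mul0r mul1r add0r mul0r addr0 => ->.
  by exists eis0; rewrite ?ev0 ?inE.
rewrite !elinE /= ev0 ev1 evN mul0r mul1r addr0 mulr1 => /eqP.
rewrite subr_eq0 => /eqP t2.
have : (t - ev c ^+ 2) * (t + ev c ^+ 2) == 0.
  have c3 := eunits_cube cu.
  by rewrite -subr_sqr t2 -exprM exprSr c3 mul1r subrr.
have [d du de] : exists2 d, d \in eunits & ev c ^+ 2 = ev d.
  by apply: cube_root; rewrite -exprM mulnC exprM eunits_cube // expr1n.
rewrite de mulf_eq0 subr_eq0 addr_eq0 => /orP[]/eqP->.
  by exists d; rewrite // inE mem_cat du orbT.
exists (eopp d); rewrite ?evN // inE mem_cat; apply/orP; right; apply/orP; right.
exact: (map_f eopp du).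
Qed.

Lemma rootsE_bad t : ~~ good rootsE quadsE t ->
  (exists2 r, r \in rootsE & t = ev r) \/
  (exists2 c, c \in eunits & elin (quadE0 c) (t ^+ 2) t 1 = 0).
Proof.
rewrite /good negb_and => /orP[/allPn[r rr /negPn/eqP]|/allPn[k]].
  by left; exists r.
rewrite mem_cat => /orP[|/mapP[c cu ->] /negPn/eqP]; last by right; exists c.
rewrite inE => /orP[/eqP->|/mapP[c cu ->]] /negPn/eqP.
  rewrite !elinE /= !ev0 ev1 mul0r mul1r add0r mul0r addr0 => ->.
  by left; exists eis0; rewrite ?ev0 ?inE.
rewrite !elinE /= ev1 evN !evM ev2 => h; left.
have : (t - ev c) * (t - - (2 * ev c)) == 0.
  by apply/eqP; rewrite -[RHS]h; ring.
rewrite mulf_eq0 !subr_eq0 => /orP[]/eqP->.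
  by exists c; rewrite // inE mem_cat cu orbT.
exists (eopp (emul eis2 c)); rewrite ?evN ?evM ?ev2 // inE mem_cat.
by apply/orP; right; apply/orP; right; apply/mapP; exists c.
Qed.

Definition s3 : C := 1 + sqrtC 3.

Lemma s3E : s3 ^+ 2 = 2 * s3 + 2.
Proof.
have := sqrtCK (3 : C); rewrite /s3 => h.
move: (sqrtC 3) h => q h.
by transitivity (1 + 2 * q + q ^+ 2); [ring | rewrite h; ring].
Qed.

Lemma orbit_s3 (t : C) : t ^+ 2 = 2 * t + 2 -> orbit t 1 1 = orbit s3 1 1.
Proof.
move=> t2; have : (t - s3) * (t - (2 - s3)) == 0.
  apply/eqP; transitivity (t ^+ 2 - 2 * t + 2 * s3 - s3 ^+ 2); first by ring.
  by rewrite t2 s3E; ring.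
rewrite mulf_eq0 !subr_eq0 => /orP[]/eqP-> {t t2} //.
have := sqrt3_conj; rewrite hasbE => /hasP[A AG].
case eA: A AG => [p q r] AG; rewrite /famE; case: ifP => //.
rewrite -!(ev_eq0 R) !(evD, evB, evM) ev2.
move=> /andP[/eqP h1 /eqP h2] /andP[/eqP h3 /eqP h4].
apply: (orbit_eq (map_f gC AG)); rewrite ?vec3_neq0 //.
rewrite /gC -scalemxAl memvZ // evmM mem_line_vec3 ?vec3_neq0 // !elinE /=.
set t := s3 in h1 h2 h3 h4 *; have t2 := s3E; rewrite -/t in t2.
move: (ev (e1 p)) (ev (e2 p)) (ev (e3 p)) (ev (e1 q)) (ev (e2 q)) (ev (e3 q))
  (ev (e1 r)) (ev (e2 r)) (ev (e3 r)) h1 h2 h3 h4.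
move=> a b c d e f g h i h1 h2 h3 h4.
(* With (p, q, r) the image of (2 - t, 1, 1), this is r = q, and [E2] is p = t * q: after reduction
   by t ^ 2 = 2 * t + 2, the coefficients are those checked to be zero. *)
have E1 : g * (2 - t) + h * 1 + i * 1 = d * (2 - t) + e * 1 + f * 1.
  apply/eqP; rewrite -subr_eq0; apply/eqP.
  transitivity (- (d - g) * (2 - t) - (e + f - (h + i))); first by ring.
  by rewrite h1 h2; ring.
have E2 : a * (2 - t) + b * 1 + c * 1 = t * (d * (2 - t) + e * 1 + f * 1).
  apply/eqP; rewrite -subr_eq0; apply/eqP.
  transitivity (2 * a + (b + c + 2 * d) - (a + (e + f)) * t
    + d * (t ^+ 2 - (2 * t + 2))); first by ring.
  by rewrite h3 h4 t2; ring.
by rewrite E1 E2 !mul1r !eqxx.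
Qed.

Inductive orbit_class (nu : C) (O : set {vspace V}) : Prop :=
| Class216 of line_orbits_of 216 0 0 O
| Class72_0 of O = orbit nu (nu ^+ 2) 1
| Class108 t of good rootsE quadsE t & O = orbit t 1 1
| Class54 of O = orbit s3 1 1
| Class72_1 t of good rootsH quadsH t & O = orbit t 1 0
| Class36 of O = eorbit pt36
| Class12 of O = eorbit pt12
| Class9 of O = eorbit pt9.

Lemma orbit_eis a b c (x y z : C) : ev a = x -> ev b = y -> ev c = z ->
  orbit x y z = eorbit (EVec a b c).
Proof. by move=> <- <- <-. Qed.

Lemma class_H nu x y : vec3 x y 0 != 0 -> orbit_class nu (orbit x y 0).
Proof.
have [->|y0] := eqVneq y 0.
  rewrite vec3_eq0 !eqxx /= !andbT => x0; apply: Class12.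
  rewrite -[x]mulr1 -(mulr0 x) orbit_scale //.
  by apply: orbit_eis; rewrite ?ev0 ?ev1.
move=> _; have -> : orbit x y 0 = orbit (x / y) 1 0.
  by rewrite -(orbit_scale (x / y) 1 0 y0) mulrCA mulfV // !mulr1 mulr0.
case gt : (good rootsH quadsH (x / y)); first by apply: Class72_1 gt _.
have [r rr ->] := rootsH_bad (negbT gt).
rewrite (orbit_eis (erefl (ev r)) (ev1 R) (ev0 R)).
move: rr; rewrite inE mem_cat => /or3P[/eqP->|ru|/mapP[c cu ->]].
- by apply: Class12; apply: orbit_conj => //; apply: (allP pt12_conj); rewrite inE.
- apply: Class36; apply: orbit_conj => //; first by rewrite /vec0b; case: ifP.
  by apply: (allP pt36_conj); rewrite mem_cat (map_f (fun w => EVec w eis1 eis0)).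
- apply: Class9; apply: orbit_conj => //; first by rewrite /vec0b; case: ifP.
  by apply: (allP pt9_conj); rewrite (map_f (fun w => EVec (eopp w) eis1 eis0)).
Qed.

Lemma class_E nu x y : vec3 x y y != 0 -> orbit_class nu (orbit x y y).
Proof.
have [->|y0] := eqVneq y 0; first exact: class_H.
move=> _; have -> : orbit x y y = orbit (x / y) 1 1.
  by rewrite -(orbit_scale (x / y) 1 1 y0) mulrCA mulfV // !mulr1.
case gt : (good rootsE quadsE (x / y)); first by apply: Class108 gt _.
have [[r rr ->]|[c cu]] := rootsE_bad (negbT gt).
  rewrite (orbit_eis (erefl (ev r)) (ev1 R) (ev1 R)).
  move: rr; rewrite inE mem_cat => /or3P[/eqP->|ru|/mapP[c cu ->]].
  - exact: Class36.
  - apply: Class12; apply: orbit_conj => //; first by rewrite /vec0b; case: ifP.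
    by apply: (allP pt12_conj); rewrite inE (map_f (fun w => EVec w eis1 eis1)) ?orbT.
  - apply: Class36; apply: orbit_conj => //; first by rewrite /vec0b; case: ifP.
    apply: (allP pt36_conj); rewrite mem_cat.
    by rewrite (map_f (fun w => EVec (eopp (emul eis2 w)) eis1 eis1)) ?orbT.
set t := x / y; rewrite !elinE /= ev1 !evN !evM ev2 => h; apply: Class54.
(* As [ev c] is a cube root of unity, s = t / c; a diagonal element absorbs c, and s ^ 2 = 2 * s +
   2. *)
have c3 := eunits_cube cu; set s := ev c ^+ 2 * t.
have ts : t = ev c * s by rewrite /s mulrA -exprS c3 mul1r.
have o1 : eis1 \in eunits by rewrite inE.
have := orbit_diag s 1 1 cu o1 o1; rewrite ev1 !mul1r -ts => ->; apply: orbit_s3.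
apply/eqP; rewrite -subr_eq0; apply/eqP.
rewrite -[RHS](mulr0 (ev c)) -[in RHS]h /s.
transitivity ((ev c ^+ 3) * ev c * t ^+ 2 - 2 * (ev c ^+ 2 * t) - 2); first by ring.
rewrite c3; transitivity (ev c * t ^+ 2 - 2 * (ev c ^+ 2 * t) - 2 * ev c ^+ 3).
  by rewrite c3; ring.
by ring.
Qed.

End NormalForms.

(** * Lines fixed by a nonscalar element *)

Section FixedLines.
Variable R : realType.
Local Notation C := R[i].
Local Notation V := 'cV[C]_3.
Local Notation w := (@omega R).
Local Notation ev := (@ev R).
Local Notation evm := (@evm R).
Local Notation gC := (@gC R).
Local Notation Gs := (@Gs R).
Local Notation elin := (@elin R).
Local Notation orbit x y z := (line_orbit <[vec3 x%R y%R z%R]>%VS).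
Local Notation ehyp := (@ehyp R).

(** If nu ^ 3 = omega, then l / nu is a cube root of unity and a diagonal element suffices.
    Otherwise nu ^ 3 = omega ^ 2 and nu ^ 6 = omega, so l is compared with nu ^ 2 and the first two
    coordinates are exchanged. *)
Lemma orbit_root (nu l : C) : 9.-primitive_root nu -> l ^+ 3 = w ->
  orbit l (l ^+ 2) 1 = orbit nu (nu ^+ 2) 1.
Proof.
move=> nu9 l3; have n9 := prim_expr_order nu9.
have nu0 : nu != 0 by apply: contra_eq_neq n9 => ->; rewrite expr0n /= eq_sym oner_eq0.
have n3 : nu ^+ 3 != 1 by rewrite -(prim_order_dvd nu9).
have o1 : eis1 \in eunits by rewrite inE.
have dg a b : a ^+ 3 = 1 -> b ^+ 3 = 1 -> forall x y : C,
    orbit (a * x) (b * y) 1 = orbit x y 1.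
  move=> /cube_root[c cu ->] /cube_root[d du ->] x y.
  by have := orbit_diag x y 1 cu du o1; rewrite ev1 mulr1.
have : (nu ^+ 3 - w) * (nu ^+ 3 - w ^+ 2) == 0.
  have := n3; rewrite -subr_eq0 => /mulfI/inj_eq <-; rewrite mulr0; apply/eqP.
  transitivity (nu ^+ 9 - 1); first by rewrite omega2E; ring: (omega2E R).
  by rewrite n9 subrr.
rewrite mulf_eq0 !subr_eq0 => /orP[]/eqP e.
  have u3 : (l / nu) ^+ 3 = 1.
    by rewrite expr_div_n l3 e mulfV // -e expf_neq0.
  have := dg _ _ u3 (_ : ((l / nu) ^+ 2) ^+ 3 = 1) nu (nu ^+ 2).
  by rewrite -exprMn !divfK //; apply; rewrite exprAC u3 expr1n.
have u3 : (l / nu ^+ 2) ^+ 3 = 1.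
  rewrite expr_div_n l3 exprAC e -exprM -[(2 * 2)%N]/(3 + 1)%N exprD omegaX3.
  rewrite mul1r expr1 mulfV //; apply: contra_eq_neq (omegaX3 R) => ->.
  by rewrite expr0n eq_sym oner_eq0.
have w0 : w ^+ 3 = 1 := omegaX3 R.
have v3 : ((l / nu ^+ 2) ^+ 2 * nu ^+ 3) ^+ 3 = 1.
  by rewrite exprMn exprAC u3 expr1n mul1r -exprM.
have := dg _ _ u3 v3 (nu ^+ 2) nu; rewrite divfK ?expf_neq0 //.
have -> : (l / nu ^+ 2) ^+ 2 * nu ^+ 3 * nu = l ^+ 2.
  by rewrite expr_div_n -exprM -mulrA -exprSr divfK ?expf_neq0.
by move=> ->; rewrite orbit_swap.
Qed.

(** For the two diagonal representatives x and z belong to different eigenvalues, so one of them is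
    0. For the transposition, a nonzero x fixes the eigenvalue and forces y = z. The last
    representative gives y = l * x and x = l * z. *)
Lemma class_rep_fixes g (x y z mu : C) : g \in class_reps ->
  evm g *m vec3 x y z = mu *: vec3 x y z ->
  [\/ z = 0, x = 0, y = z | exists2 l, l ^+ 3 = w & vec3 x y z = z *: vec3 l (l ^+ 2) 1].
Proof.
set t := ev eistheta; have t0 : t != 0 := ev_theta_neq0 R.
have [->|z0] := eqVneq z 0; first by move=> _ _; constructor 1.
have [->|x0] := eqVneq x 0; first by move=> _ _; constructor 2.
have w2 : w ^+ 2 != 1.
  by apply/eqP => h; move/eqP: (omegaX3 R); rewrite exprS h mulr1 (negPf (omega_neq1 R)).
rewrite evmM scale_vec3 !elinE !inE => /or4P[]/eqP-> /=;
  rewrite !(evM, evN) !(ev0, ev1, evw, evw2) !(mulr0, mul0r, add0r, addr0, mulr1) -/t;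
  move=> /vec3_inj[h1 h2 h3].
- have := mulIf x0 h1 => e; move: h3; rewrite -e => /(mulIf z0)/eqP.
  by rewrite -[X in _ == X]mulr1 (inj_eq (mulfI t0)) (negPf w2).
- have := mulIf x0 h1 => e; move: h3; rewrite -e => /(mulIf z0)/eqP.
  by rewrite -[X in _ == X]mulr1 (inj_eq (mulfI t0)) (negPf w2).
- have := mulIf x0 h1 => e; constructor 3; move: h3; rewrite -e.
  by apply: mulfI; rewrite oppr_eq0.
- constructor 4; exists (mu / t).
    have e1 : y = mu / t * x by apply: (mulfI t0); rewrite h1 mulrA mulrCA mulfV ?mulr1.
    have e3 : x = mu / t * z by apply: (mulfI t0); rewrite h3 mulrA mulrCA mulfV ?mulr1.
    have e2 : w * z = mu / t * y.
      by apply: (mulfI t0); rewrite mulrA h2 mulrA mulrCA mulfV ?mulr1.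
    by apply: (mulIf z0); rewrite e2 e1 e3 !exprS expr0 mulr1 !mulrA.
  have e1 : y = mu / t * x by apply: (mulfI t0); rewrite h1 mulrA mulrCA mulfV ?mulr1.
  have e3 : x = mu / t * z by apply: (mulfI t0); rewrite h3 mulrA mulrCA mulfV ?mulr1.
  by rewrite scale_vec3 mulr1 e1 {1 2}e3; congr vec3; ring.
Qed.

Lemma fix_conj A (v : V) : v != 0 -> A \in Gl -> ~~ scalarb A ->
  gC A *m v \in <[v]>%VS ->
  exists g h mu, [/\ g \in class_reps, h \in Gs & evm g *m (h *m v) = mu *: (h *m v)].
Proof.
move=> v0 AG nsA /vlineP[la0]; set la := ev eistheta * la0 => ela.
have {}ela : evm A *m v = la *: v by rewrite evm_gC -scalemxAl ela scalerA.
(* A power of A still has v as an eigenvector, so it may be replaced by the conjugate M that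
   [fix_check] finds. *)
suff [M [mu [Mc e]]] : exists M mu, M \in conjugates /\ evm M *m v = mu *: v.
  move: Mc => /allpairsP[[h g] /= [hs gr eM]]; exists g.
  have /mapP[u us hu] := hs.
  have hG : h \in Gl.
    rewrite hu GlE; apply: map_f; apply/allpairsP; exists (u, [::]).
    by rewrite cats0 /=; split.
  have gG := map_f gC hG.
  have adj : evm (madj h) *m evm h = 3%:M.
    rewrite -evm_mul; have /(meqP R) -> := allP short_adj h hs.
    rewrite evm_mscal; congr (_%:M).
    by rewrite -[eis3]/(eadd eis1 (eadd eis1 eis1)) !evD ev1; ring.
  exists (invmx (gC h)), (mu / 3); split; [exact: gr | exact: Gs_invmx |].
  have t3 : (3 : C) != 0 by rewrite pnatr_eq0.
  have e' : invmx (gC h) *m v = (ev eistheta / 3) *: (evm (madj h) *m v).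
    have -> : evm (madj h) *m v = ((ev eistheta)^-1 * 3) *: (invmx (gC h) *m v).
      rewrite -mul_scalar_mx -scale_scalar_mx -adj scalemxAr -/(gC h) -mulmxA.
      by rewrite mulKVmx ?(Gs_unit gG).
    rewrite scalerA -[LHS]scale1r; congr (_ *: _).
    by rewrite mulrACA mulfV ?ev_theta_neq0 // mulVf // mulr1.
  rewrite e' -scalemxAr !scalerA [mu / 3 * _]mulrC -[RHS]scalerA; congr (_ *: _).
  apply: (scalerI t3); rewrite [RHS]scalerA [3 * _]mulrCA mulfV // mulr1.
  transitivity (evm (madj h) *m (evm M *m v)); last by rewrite e -scalemxAr.
  by rewrite eM !evm_mul !mulmxA adj -mulmxA mul_scalar_mx !mulmxA -!scalemxAl.
have := allP fix_check_true A AG; rewrite /fix_check (negPf nsA) !hasbE.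
move=> /hasP[c cu]; have A2 : evm (mmul A A) *m v = la ^+ 2 *: v.
  by rewrite evm_mul -mulmxA ela -scalemxAr ela scalerA.
have A3 : evm (mmul (mmul A A) A) *m v = la ^+ 3 *: v.
  by rewrite evm_mul -mulmxA ela -scalemxAr A2 scalerA -exprS.
rewrite !hasbE; case: ifP => [/hasP[M Mc /(meqP R) e] _|_].
  by exists M, (ev (emul eis3 c) * la); rewrite -e evm_scal -scalemxAl ela scalerA.
case: ifP => [/hasP[M Mc /(meqP R) e] _|_ /hasP[M Mc /(meqP R) e]].
  rewrite !evm_scal in e; exists M, ((ev eistheta)^-1 * (ev (emul eis3 c) * la ^+ 2)).
  split=> //; apply: (scalerI (ev_theta_neq0 R)).
  by rewrite scalemxAl -e -scalemxAl A2 !scalerA mulVKf ?ev_theta_neq0.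
rewrite !evm_scal in e.
have tt : ev (emul eistheta eistheta) != 0 by rewrite ev_eq0.
exists M, ((ev (emul eistheta eistheta))^-1 * (ev (emul eis3 c) * la ^+ 3)).
split=> //; apply: (scalerI tt).
by rewrite scalemxAl -e -scalemxAl A3 !scalerA mulVKf.
Qed.

Lemma classification (nu : C) (v : V) : 9.-primitive_root nu -> v != 0 ->
  orbit_class nu (line_orbit <[v]>%VS).
Proof.
have [x [y [z ->]]] := vec3_surj v => nu9 v0.
have [/hasP[l lF /eqP h]|/hasPn nr] := boolP (has (fun l => elin l x y z == 0) refl_forms).
  by have [x' [y' [v'0 ->]]] := on_reflection v0 lF h; apply: class_H.
have [/hasP[l lF /eqP h]|/hasPn np] := boolP (has (fun l => elin l x y z == 0) proper_forms).
  by have [x' [y' [v'0 ->]]] := on_proper v0 lF h; apply: class_E.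
have [/hasP[A AG /andP[nsA]]|/hasPn nf] :=
  boolP (has (fun A => ~~ scalarb A && fixes A x y z) Gl).
  rewrite fixesE // => fA.
  have [g [h [mu [gr hG]]]] := fix_conj v0 AG nsA fA.
  (* The group permutes the planes of each kind, so the moved vector is on none of them either; this
     rules out the first three cases of [class_rep_fixes]. *)
  have rv : regular_vector (h *m vec3 x y z).
    by apply: regular_vector_img => //; apply/regularP/allP.
  have pv H : proper_plane H -> h *m vec3 x y z \notin H.
    move=> /(proper_plane_img (Gs_invmx hG)) /proper_planeP/mapP[l lF e].
    have := np l lF; rewrite -mem_ehyp -e mem_endo_img ?unitmx_inv ?(Gs_unit hG) //.
    by rewrite invmxK.
  rewrite -(orbit_img _ hG); have hv0 : h *m vec3 x y z != 0.
    by rewrite mulmx_eq0 ?(Gs_unit hG).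
  move: rv pv hv0; have [x' [y' [z' ->]]] := vec3_surj (h *m vec3 x y z).
  move=> /regularP/allP rv pv hv0 /(class_rep_fixes gr)[e|e|e|[l l3 e]].
  - have f : EVec eis0 eis0 eis1 \in refl_forms by [].
    by have := rv _ f; rewrite e !elinE /= !ev0 !mul0r mulr0 !addr0 eqxx.
  - have f : EVec eis1 eis0 eis0 \in refl_forms by [].
    by have := rv _ f; rewrite e !elinE /= !ev0 !mul0r mulr0 !addr0 eqxx.
  - have f : EVec eis0 eis1 (eopp eis1) \in proper_forms by [].
    have /proper_planeP/pv : ehyp (EVec eis0 eis1 (eopp eis1)) \in map ehyp proper_forms.
      exact: map_f.
    by rewrite mem_ehyp e !elinE /= ev0 evN ev1 mul0r add0r mul1r mulN1r subrr eqxx.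
  - apply: Class72_0; rewrite -(orbit_root nu9 l3) e.
    move: hv0; rewrite e scaler_eq0 negb_or => /andP[z0 _].
    by rewrite scale_vec3 orbit_scale.
apply: Class216; apply: type216 => //.
  by move=> l; rewrite mem_cat => /orP[/nr|/np].
by move=> A /nf; rewrite negb_and negbK => /orP[//|/negPf->].
Qed.

Lemma type_P72 (nu : C) : 9.-primitive_root nu ->
  line_orbits_of 72 0 0 (orbit nu (nu ^+ 2) 1).
Proof.
move=> nu9; have n9 := prim_expr_order nu9.
have n3 : nu ^+ 3 != 1 by rewrite -(prim_order_dvd nu9).
(* Take nu if nu ^ 3 = omega, and nu ^ 2 if nu ^ 3 = omega ^ 2. *)
have [l l3] : exists l, l ^+ 3 = w.
  have [c cu e] : exists2 c, c \in eunits & nu ^+ 3 = ev c.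
    by apply: cube_root; rewrite -exprM.
  move: cu; rewrite !inE => /or3P[]/eqP ec; move: e; rewrite ec ?ev1 ?evw ?evw2 => e.
  - by rewrite e eqxx in n3.
  - by exists nu.
  - exists (nu ^+ 2); rewrite exprAC e -exprM -[(2 * 2)%N]/(3 + 1)%N exprD omegaX3.
    by rewrite mul1r expr1.
by rewrite -(orbit_root nu9 l3) orbit_swap; apply: type72_0.
Qed.

End FixedLines.

(** * The Zariski topology on the set of orbits *)

Section Zariski.
Variable R : realType.
Local Notation C := R[i].
Local Notation V := 'cV[C]_3.
Local Notation Gs := (@Gs R).

Definition veval (f : {mpoly C[3]}) (v : V) : C := f.@[fun i => v i 0].

Lemma meval_pencil (f : {mpoly C[3]}) (u v : V) :
  exists q : {poly C}, forall t, q.[t] = veval f (u + t *: v).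
Proof.
exists (\sum_(m <- msupp f) f@_m *: \prod_i ((u i 0)%:P + v i 0 *: 'X) ^+ m i) => t.
rewrite /veval mevalE horner_sum; apply: eq_bigr => m _.
rewrite hornerZ horner_prod; congr (_ * _); apply: eq_bigr => i _.
by rewrite !mxE horner_exp hornerD hornerC hornerZ hornerX mulrC.
Qed.

Lemma veval_homogZ d (f : {mpoly C[3]}) k v : f \is d.-homog ->
  veval f (k *: v) = k ^+ d * veval f v.
Proof.
move=> /dhomogP fd; rewrite /veval !mevalE mulr_sumr big_seq [RHS]big_seq.
apply: eq_bigr => m /fd md; rewrite mulrCA; congr (_ * _).
rewrite -(md : mdeg m = d) mdegE -prodrXr -big_split; apply: eq_bigr => i _.
by rewrite mxE exprMn.
Qed.

Definition lform (a : 'rV[C]_3) : {mpoly C[3]} := \sum_i a 0 i *: 'X_i.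

Lemma veval_lform a v : veval (lform a) v = (a *m v) 0 0.
Proof.
rewrite /veval /lform raddf_sum mxE; apply: eq_bigr => i _.
by rewrite /= mevalZ mevalXU.
Qed.

Lemma lform_homog a : lform a \is 1.-homog.
Proof. by apply: rpred_sum => i _; apply: dhomogZ; rewrite dhomogX /= mdeg1. Qed.

Lemma lform_prod_homog (T : Type) (s : seq T) (a : T -> 'rV[C]_3) :
  \prod_(x <- s) lform (a x) \is (size s).-homog.
Proof.
elim: s => [|x s IH]; first by rewrite big_nil; exact: dhomog1.
by rewrite big_cons; exact: (dhomogM (lform_homog (a x)) IH).
Qed.

Lemma veval_prod (T : Type) (s : seq T) (f : T -> {mpoly C[3]}) v :
  veval (\prod_(x <- s) f x) v = \prod_(x <- s) veval (f x) v.
Proof. by rewrite /veval rmorph_prod. Qed.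

Lemma veval_line0 d f (v u : V) : f \is d.-homog -> veval f v = 0 ->
  u \in <[v]>%VS -> veval f u = 0.
Proof. by move=> fd f0 /vlineP[k ->]; rewrite (veval_homogZ _ _ fd) f0 mulr0. Qed.

Lemma mul_row3 a b c x y z :
  (((vec3 a b c)^T : 'rV[C]_3) *m vec3 x y z) 0 0 = a * x + b * y + c * z.
Proof. by rewrite !mxE !big_ord_recr big_ord0 /= !mxE /= add0r. Qed.

Lemma separate_lines (u v : V) : u != 0 -> v \notin <[u]>%VS ->
  exists a : 'rV[C]_3, (a *m u) 0 0 = 0 /\ (a *m v) 0 0 != 0.
Proof.
have [x [y [z ->]]] := vec3_surj u; have [x' [y' [z' ->]]] := vec3_surj v.
move=> u0; rewrite mem_line_vec3 // !negb_and => /or3P[] h.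
- exists (vec3 0 (- z) y)^T; rewrite !mul_row3; split; first by ring.
  by rewrite [X in X != 0](_ : _ = y * z' - z * y') ?subr_eq0 //; ring.
- exists (vec3 z 0 (- x))^T; rewrite !mul_row3; split; first by ring.
  by rewrite [X in X != 0](_ : _ = z * x' - x * z') ?subr_eq0 //; ring.
- exists (vec3 (- y) x 0)^T; rewrite !mul_row3; split; first by ring.
  by rewrite [X in X != 0](_ : _ = x * y' - y * x') ?subr_eq0 //; ring.
Qed.

(** A line outside Z is separated from it by a product of linear forms, one for each line of Z. *)
Lemma finite_line_closed (Z : set {vspace V}) :
  finite_set Z -> Z `<=` @line R -> line_closed Z.
Proof.
move=> /finite_seqP[s ->] sl.
exists [set f | (exists d, f \is d.-homog) /\
    forall L v, L \in s -> v \in L -> veval f v = 0]; first by move=> f [].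
apply/seteqP; split => [L Ls|L [/lineP[v v0 ->] vL]].
  by split; [exact: sl | move=> f v [_ fs]; exact: fs].
apply: contrapT => nLs.
(* The implication is under the existential so that [choice] applies to all subspaces; outside [s]
   the form 0 serves. *)
have sep (M : {vspace V}) : exists a : 'rV[C]_3, M \in s ->
    (forall u, u \in M -> (a *m u) 0 0 = 0) /\ (a *m v) 0 0 != 0.
  have [Ms|_] := boolP (M \in s); last by exists 0.
  have /lineP[u u0 eM] := sl M Ms.
  have [a [au av]] : exists a : 'rV[C]_3, (a *m u) 0 0 = 0 /\ (a *m v) 0 0 != 0.
    apply: separate_lines => //; apply/negP => vu; apply: nLs.
    suff -> : <[v]>%VS = M by [].
    by rewrite eM; apply/eqP; rewrite eq_line.
  exists a => _; split => // u'; rewrite eM => /vlineP[k ->].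
  by rewrite -scalemxAr mxE au mulr0.
have [a aP] := choice sep.
have : veval (\prod_(M <- s) lform (a M)) v = 0.
  apply: vL (memv_line v); split; first by exists (size s); exact: lform_prod_homog.
  move=> M u Ms uM; rewrite veval_prod; apply/eqP; rewrite prodf_seq_eq0.
  by apply/hasP; exists M => //=; rewrite veval_lform (aP M Ms).1.
rewrite veval_prod => /eqP; rewrite prodf_seq_eq0 => /hasP[M Ms /=].
by rewrite veval_lform (negPf (aP M Ms).2).
Qed.

Lemma finite_line_orbit (v : V) : finite_set (line_orbit <[v]>%VS).
Proof. by rewrite line_orbitE; apply: finite_image; exact: finite_seq. Qed.

Lemma line_orbit_refl (L : {vspace V}) : line L -> line_orbit L L.
Proof.
move=> /lineP[v v0 ->]; rewrite line_orbitE; exists 1%:M; first exact: Gs1.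
by rewrite mul1mx.
Qed.

Lemma line_orbit_line (L M : {vspace V}) : line L -> line_orbit L M -> line M.
Proof.
move=> /lineP[v v0 ->]; rewrite line_orbitE => -[g gG <-]; apply/lineP.
by exists (g *m v); rewrite // mulmx_eq0 ?(Gs_unit gG).
Qed.

Lemma line_orbit_eq (L M : {vspace V}) : line L -> line_orbit L M ->
  line_orbit M = line_orbit L.
Proof.
by move=> /lineP[v v0 ->]; rewrite line_orbitE => -[g gG <-]; rewrite -line_orbitE orbit_img.
Qed.

Lemma line_orbits_eq (O : set {vspace V}) L : line_orbits O -> O L ->
  line L /\ O = line_orbit L.
Proof.
move=> [M lM <-] ML; split; first exact: line_orbit_line ML.
by rewrite (line_orbit_eq lM ML).
Qed.

Lemma finite_orbit_closed (A : set (set {vspace V})) :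
  finite_set A -> A `<=` @line_orbits R -> orbit_closed A.
Proof.
move=> fA Al; split => //; apply: finite_line_closed.
  apply: bigcup_finite => // O /Al[L /lineP[v _ ->] <-]; exact: finite_line_orbit.
by move=> L [O /Al Ol OL]; have [] := line_orbits_eq Ol OL.
Qed.

Lemma line_orbits_closed : orbit_closed (@line_orbits R).
Proof.
split => //; exists set0 => //; apply/seteqP; split => [L [O Ol OL]|L [lL _]].
  by split => //; have [] := line_orbits_eq Ol OL.
by exists (line_orbit L); [exists L | exact: line_orbit_refl].
Qed.

Lemma poly_eq0_fun (p : {poly C}) : (forall t, p.[t] = 0) -> p = 0.
Proof.
move=> p0; apply/eqP; apply: contraT => pn0.
have := max_poly_roots pn0 (_ : all (root p) [seq i%:R | i <- iota 0 (size p)]).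
rewrite size_map size_iota ltnn => -> //.
  by apply/allP => t _; rewrite rootE p0.
by rewrite map_inj_uniq ?iota_uniq // => i j /eqP; rewrite eqr_nat => /eqP.
Qed.

Lemma finite_roots (p : {poly C}) : p != 0 -> finite_set [set t | p.[t] = 0].
Proof.
move=> p0; have [r pr] := closed_field_poly_normal p.
apply: (sub_finite_set _ (finite_seq r)) => t /= /eqP.
rewrite pr hornerZ mulf_eq0 lead_coef_eq0 (negPf p0) /= -rootE.
by rewrite root_prod_XsubC.
Qed.

Lemma infinite_C : infinite_set [set: C].
Proof.
move=> fC; apply: infinite_nat.
rewrite -(preimage_setT (fun n : nat => n%:R : C)); apply: finite_preimage fC.
by move=> i j _ _ /eqP; rewrite eqr_nat => /eqP.
Qed.

(** * Dimension of the set of orbits met by a pencil of lines *)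

Section Pencil.
Variables (u v : V) (P : C -> bool).
Hypothesis uv : forall t, u + t *: v != 0.
Hypothesis uv_inj : injective (fun t : C => <[u + t *: v]>%VS).
Hypothesis P_cofinite : finite_set [set t | ~~ P t].
Let O t := line_orbit <[u + t *: v]>%VS.
Let S : set (set {vspace V}) := [set O t | t in [set t | P t]].

Lemma pencil_line t : line <[u + t *: v]>%VS.
Proof. by apply/lineP; exists (u + t *: v). Qed.

Lemma pencil_orbits : S `<=` @line_orbits R.
Proof. by move=> _ [t _ <-]; exists <[u + t *: v]>%VS => //; exact: pencil_line. Qed.

(** Orbits are finite and t is determined by its line, so each orbit is met for only finitely many
    t. *)
Lemma pencil_infinite : infinite_set S.
Proof.
move=> fS; apply: infinite_C.
have : finite_set ((fun t : C => <[u + t *: v]>%VS) @^-1` \bigcup_(o in S) o).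
  apply: finite_preimage; first by move=> a b _ _; exact: uv_inj.
  by apply: bigcup_finite => // _ [t _ <-]; exact: finite_line_orbit.
move=> fp; have fU : finite_set ([set t | ~~ P t] `|`
    (fun t : C => <[u + t *: v]>%VS) @^-1` \bigcup_(o in S) o).
  by rewrite finite_setU.
apply: sub_finite_set fU => t _; have [Pt|] := boolP (P t); last by left.
by right; exists (O t); [exists t | exact/line_orbit_refl/pencil_line].
Qed.

(** An equation of A that is not identically zero on the pencil restricts to a nonzero polynomial in
    t, which has finitely many roots. *)
Lemma pencil_dichotomy A : orbit_closed A -> S `<=` A \/ finite_set (S `&` A).
Proof.
move=> [Al [I Ih IE]].
have mem t : A (O t) <-> (\bigcup_(o in A) o) <[u + t *: v]>%VS.
  split => [At|[o Ao ot]]; first by exists (O t) => //; exact/line_orbit_refl/pencil_line.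
  by have [_ e] := line_orbits_eq (Al _ Ao) ot; rewrite /O -e.
have [h|/existsNP[f /existsNP[t0 /not_implyP[If ft0]]]] :=
    pselect (forall f t, I f -> veval f (u + t *: v) = 0).
  left => _ [t _ <-]; apply/mem; rewrite IE; split; first exact: pencil_line.
  move=> f x If xL; have [d fd] := Ih f If.
  exact: veval_line0 fd (h f t If) xL.
right; have [q qE] := meval_pencil f u v.
have q0 : q != 0 by apply/eqP => q0; apply: ft0; rewrite -qE q0 horner0.
apply: sub_finite_set (finite_image O (finite_roots q0)) => _ [[t _ <-] /mem].
rewrite IE => -[_ /(_ f _ If (memv_line _)) ft]; exists t => //=.
by rewrite qE.
Qed.

Lemma pencil_dimension : has_dimension (@orbit_closed R) S 1.
Proof.
have Sinf := pencil_infinite.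
have clS : induced_closed (@orbit_closed R) S S.
  exists (@line_orbits R); first exact: line_orbits_closed.
  by apply/setIidPl; exact: pencil_orbits.
have clF (B : set (set {vspace V})) : finite_set B -> B `<=` S ->
    induced_closed (@orbit_closed R) S B.
  move=> fB BS; exists B; last exact/setIidPr.
  by apply: finite_orbit_closed => //; exact: subset_trans BS pencil_orbits.
split.
  have /infinite_setN0[o So] := Sinf.
  (* The chain is a point followed by S; S is irreducible because an infinite set is not the union
     of two finite ones. *)
  exists (fun i => if i is 0%N then [set o] else S); split => [[|i] _|[|i] //= _].
  - split; [by apply: clF => [|_ ->] | by exists o |].
    move=> A B _ _ e; have : (A `|` B) o by rewrite -e.
    have sA : A `<=` [set o] by rewrite e; exact: subsetUl.
    have sB : B `<=` [set o] by rewrite e; exact: subsetUr.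
    by move=> [Ao|Bo]; [left | right]; apply/seteqP; split => // _ ->.
  - split => //; first by exists o.
    move=> A B [A' cA eA] [B' cB eB] e.
    have [SA|fA] := pencil_dichotomy cA.
      by left; rewrite -eA; apply/esym/setIidPl.
    have [SB|fB] := pencil_dichotomy cB.
      by right; rewrite -eB; apply/esym/setIidPl.
    by case: Sinf; rewrite e -eA -eB finite_setU.
  - split => [_ -> //|So1]; apply: Sinf.
    by apply: sub_finite_set So1 _; exact: finite_set1.
(* In a longer chain, c 1 is a proper closed subset of S, hence finite. It strictly contains c 0, so
   it splits into one point and a nonempty rest, against irreducibility. *)
move=> n c [irr ch]; rewrite leqNgt; apply/negP => n2.
have [[A1 cA1 e1] [o1 _] irr1] := irr 1%N (ltnW n2).
have [_ [o0 c0o0] _] := irr 0%N (leq0n n).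
have [c01 nc10] := ch 0%N (ltnW n2); have [c12 nc21] := ch 1%N n2.
have [[A2 _ e2] _ _] := irr 2%N n2.
have [SA|fA] := pencil_dichotomy cA1.
  by apply: nc21; rewrite -e2 -e1 => o [So _]; split => //; exact: SA.
have c1S : c 1%N `<=` S by rewrite -e1; exact: subIsetl.
rewrite -/(S `&` A1) e1 in fA.
have f1 : finite_set [set o0] by exact: finite_set1.
have [|||e|e] := irr1 [set o0] (c 1%N `\` [set o0]).
- by apply: clF => // _ ->; apply/c1S/c01.
- apply: clF; first exact: finite_setD.
  by move=> o [/c1S].
- by apply/esym/setDUK => _ ->; exact: c01.
- by apply: nc10; rewrite e => _ ->.
- by have : c 1%N o0 := c01 _ c0o0; rewrite e => -[_]; apply.
Qed.

End Pencil.

(** On the curve (1, t, t ^ 2) a nonzero linear form becomes a nonzero polynomial, and so does a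
    finite product of such forms. *)
Lemma avoid_planes (s : seq 'rV[C]_3) : all (fun a => a != 0) s ->
  exists v : V, {in s, forall a, (a *m v) 0 0 != 0}.
Proof.
move=> s0.
pose q (a : 'rV[C]_3) : {poly C} := \poly_(i < 3) a 0 (inord i).
have qE a t : (q a).[t] = (a *m \col_i t ^+ i) 0 0.
  rewrite horner_poly !mxE; apply: eq_bigr => i _.
  by rewrite !mxE inord_val.
have q0 a : a != 0 -> q a != 0.
  apply: contra_neq => e; apply/rowP => i; rewrite mxE.
  by have := congr1 (fun p : {poly C} => p`_i) e; rewrite coef_poly ltn_ord inord_val coef0.
have : \prod_(a <- s) q a != 0.
  by rewrite prodf_seq_neq0; apply/allP => a /(allP s0) /q0.
have [e|/existsNP[t /eqP ht] _] := pselect (forall t, (\prod_(a <- s) q a).[t] = 0).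
  by rewrite (poly_eq0_fun e) eqxx.
exists (\col_i t ^+ i) => a sa; rewrite -qE.
by move: ht; rewrite horner_prod prodf_seq_neq0 => /allP/(_ a sa).
Qed.

Lemma generic_off_planes (s : seq 'rV[C]_3) (S : set (set {vspace V})) :
  s != [::] -> all (fun a => a != 0) s ->
  (forall v : V, v != 0 -> (forall g a, g \in Gs -> a \in s -> (a *m (g *m v)) 0 0 != 0) ->
     S (line_orbit <[v]>%VS)) ->
  is_generic (@orbit_closed R) line_orbits S.
Proof.
move=> sn0 s0 hS.
pose forms := [seq a *m g | a <- s, g <- Gs].
have fn0 : all (fun a => a != 0) forms.
  apply/allP => _ /allpairsP[[a g] [/= /(allP s0) a0 gG ->]].
  by apply: contra a0 => /eqP e; rewrite -(mulmxK (Gs_unit gG) a) e mul0mx.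
pose F := \prod_(a <- forms) lform a.
have Fh : F \is (size forms).-homog by exact: (lform_prod_homog forms id).
(* A nonempty [s] makes the degree positive. The value at 0 is used below when v + t * y happens to
   vanish. *)
have F0 : veval F 0 = 0.
  rewrite -(scale0r 0) (veval_homogZ _ _ Fh) expr0n size_allpairs size_Gs.
  by rewrite muln_eq0 size_eq0 (negPf sn0) mul0r.
have FE v : veval F v == 0 = has (fun a : 'rV[C]_3 => (a *m v) 0 0 == 0) forms.
  by rewrite veval_prod prodf_seq_eq0; apply: eq_has => a; rewrite /= veval_lform.
pose Z := [set o | line_orbits o /\
   exists v : V, [/\ v != 0, o = line_orbit <[v]>%VS & veval F v = 0]].
have F_img g v : g \in Gs -> veval F v = 0 -> veval F (g *m v) = 0.
  move=> gG /eqP; rewrite FE => /hasP[_ /allpairsP[[a h] [/= sa hG ->]] e].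
  apply/eqP; rewrite FE; apply/hasP; exists (a *m (h *m invmx g)).
    apply/allpairsP; exists (a, h *m invmx g); split => //=.
    exact: Gs_mul hG (Gs_invmx gG).
  by rewrite -!mulmxA mulKmx ?(Gs_unit gG) // mulmxA.
exists Z.
  split => [o []//|]; exists [set F] => [f ->|]; first by exists (size forms).
  apply/seteqP; split => [L [o [ol [v [v0 ov Fv]]] oL]|L [/lineP[v v0 ->] h]].
    have [lL _] := line_orbits_eq ol oL; split => // f x -> xL.
    move: oL; rewrite ov line_orbitE => -[g gG eL].
    by apply: veval_line0 Fh (F_img g v gG Fv) _; rewrite eL.
  have lv : line <[v]>%VS by apply/lineP; exists v.
  exists (line_orbit <[v]>%VS); last exact: line_orbit_refl.
  split; first by exists <[v]>%VS.
  by exists v; split => //; apply: h (memv_line v).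
have off (v : V) : v != 0 -> veval F v != 0 ->
    (line_orbits `\` Z) (line_orbit <[v]>%VS).
  move=> v0 Fv; have lv : line <[v]>%VS by apply/lineP; exists v.
  split; first by exists <[v]>%VS.
  move=> [_ [x [x0 ex Fx]]]; move/eqP: Fv; apply.
  have : line_orbit <[x]>%VS <[v]>%VS by rewrite -ex; exact: line_orbit_refl.
  rewrite line_orbitE => -[g gG e].
  apply: veval_line0 Fh (F_img g x gG Fx) _; rewrite e; exact: memv_line.
split.
  move=> o [[L /lineP[v v0 ->] <-] nZ]; apply: hS => // g a gG sa.
  apply/negP => e; apply: nZ; split.
    by exists <[v]>%VS => //; apply/lineP; exists v.
  exists v; split => //; apply/eqP; rewrite FE; apply/hasP; exists (a *m g).
    by apply/allpairsP; exists (a, g).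
  by rewrite -mulmxA.
move=> Y [Yl [I Ih IE]] XY o [L /lineP[v v0 ->] <-].
have lv : line <[v]>%VS by apply/lineP; exists v.
suff : (\bigcup_(o in Y) o) <[v]>%VS.
  by move=> [o' Yo' o'v]; have [_ <-] := line_orbits_eq (Yl _ Yo') o'v.
rewrite IE; split => // f x If xv; have [d fd] := Ih f If.
apply: veval_line0 fd _ xv.
(* Density: along v + t * y no factor of F is constant in t, so F vanishes there for only finitely
   many t. Elsewhere f vanishes, hence f is zero along the whole line, and t = 0 gives the value at
   v. *)
have [y hy] := avoid_planes fn0.
have [q qE] := meval_pencil f v y; have [p pE] := meval_pencil F v y.
have p0 : p != 0.
  have pP : p = \prod_(a <- forms) (((a *m v) 0 0)%:P + (a *m y) 0 0 *: 'X).
    apply/eqP; rewrite -subr_eq0; apply/eqP/poly_eq0_fun => t.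
    rewrite hornerD hornerN pE horner_prod veval_prod; apply/eqP; rewrite subr_eq0.
    apply/eqP/eq_bigr => a _; rewrite veval_lform hornerD hornerC hornerZ hornerX.
    by rewrite mulmxDr -scalemxAr !mxE [t * _]mulrC.
  rewrite pP prodf_seq_neq0; apply/allP => a /hy ay /=.
  apply: contra_neq ay => /(congr1 (fun r : {poly C} => r`_1)).
  by rewrite coefD coefC coefZ coefX /= add0r mulr1 coef0.
have : q * p = 0.
  apply: poly_eq0_fun => t; rewrite hornerM qE.
  have [->|Ft] := eqVneq p.[t] 0; first by rewrite mulr0.
  rewrite pE in Ft *.
  have [z|z0] := eqVneq (v + t *: y) 0.
    by rewrite z F0 eqxx in Ft.
  have /XY Yo := off _ z0 Ft.
  have lz : line <[v + t *: y]>%VS by apply/lineP; exists (v + t *: y).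
  have : (\bigcup_(o in Y) o) <[v + t *: y]>%VS.
    by exists (line_orbit <[v + t *: y]>%VS) => //; exact: line_orbit_refl.
  by rewrite IE => -[_ /(_ f _ If (memv_line _))]; rewrite -/(veval f _) => ->; rewrite mul0r.
move=> /eqP; rewrite mulf_eq0 (negPf p0) orbF => /eqP q0.
by have := qE 0; rewrite q0 horner0 scale0r addr0.
Qed.

End Zariski.

(** * The table of orbits *)

Section Table.
Variable R : realType.
Local Notation C := R[i].
Local Notation V := 'cV[C]_3.
Local Notation w := (@omega R).
Local Notation ev := (@ev R).
Local Notation elin := (@elin R).
Local Notation Gs := (@Gs R).
Local Notation orbit x y z := (line_orbit <[vec3 x%R y%R z%R]>%VS).
Local Notation eorbit u := (line_orbit <[evec_col R u]>%VS).
Implicit Types (O : set {vspace V}) (L : {vspace V}).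

Lemma card_II_inj (T : Type) (A : set T) m n :
  (A #= `I_m)%card -> (A #= `I_n)%card -> m = n.
Proof.
by move=> hm hn; apply/card_eq_II; apply: card_eq_trans (card_esym hm) hn.
Qed.

Lemma line_orbits_nonempty O : line_orbits O -> exists L, O L.
Proof. by move=> [L lL <-]; exists L; exact: line_orbit_refl. Qed.

Lemma line_orbits_of_inj O n r p n' r' p' : line_orbits_of n r p O ->
  line_orbits_of n' r' p' O -> [/\ n = n', r = r' & p = p'].
Proof.
move=> [Ol cO h] [_ cO' h']; have [L OL] := line_orbits_nonempty Ol.
have [hr hp] := h L OL; have [hr' hp'] := h' L OL.
by split; [exact: card_II_inj cO cO' | exact: card_II_inj hr hr' | exact: card_II_inj hp hp'].
Qed.

(** Indexing by the triple lets [inversion] on a given triple leave only the matching row. *)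
Inductive table_row (nu : C) O : nat -> nat -> nat -> Prop :=
| Row216 : table_row nu O 216 0 0
| Row72_0 of O = orbit nu (nu ^+ 2) 1 : table_row nu O 72 0 0
| Row108 t of good rootsE quadsE t & orbit t 1 1 = O : table_row nu O 108 0 1
| Row54 of O = orbit (s3 R) 1 1 : table_row nu O 54 0 1
| Row72_1 t of good rootsH quadsH t & orbit t 1 0 = O : table_row nu O 72 1 0
| Row36 of O = eorbit pt36 : table_row nu O 36 1 1
| Row12 of O = eorbit pt12 : table_row nu O 12 2 3
| Row9 of O = eorbit pt9 : table_row nu O 9 4 0.

Lemma table_complete (nu : C) O : 9.-primitive_root nu -> line_orbits O ->
  exists n r p, table_row nu O n r p /\ line_orbits_of n r p O.
Proof.
move=> nu9 [_ /lineP[v v0 ->] <-].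
have [h|->|t gt ->|->|t gt ->|->|->|->] := classification nu9 v0.
- by exists 216%N, 0%N, 0%N; split => //; exact: Row216.
- by exists 72%N, 0%N, 0%N; split; [exact: Row72_0 | exact: type_P72].
- by exists 108%N, 0%N, 1%N; split; [exact: Row108 gt _ | exact: type108].
- by exists 54%N, 0%N, 1%N; split; [exact: Row54 | apply: type54; exact: s3E].
- by exists 72%N, 1%N, 0%N; split; [exact: Row72_1 gt _ | exact: type72_1].
- by exists 36%N, 1%N, 1%N; split; [exact: Row36 | exact: type36].
- by exists 12%N, 2%N, 3%N; split; [exact: Row12 | exact: type12].
- by exists 9%N, 4%N, 0%N; split; [exact: Row9 | exact: type9].
Qed.

(** The triple of an orbit is unique, so the row found by the classification is the one with the
    given triple. *)
Lemma table_rowP (nu : C) O n r p : 9.-primitive_root nu ->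
  line_orbits_of n r p O -> table_row nu O n r p.
Proof.
move=> nu9 h; have [Ol _ _] := h.
have [n' [r' [p' [row h']]]] := table_complete nu9 Ol.
by have [-> -> ->] := line_orbits_of_inj h h'.
Qed.

Lemma off_line_orbit (a : 'rV[C]_3) (u v : V) :
  line_orbit <[v]>%VS = line_orbit <[u]>%VS -> v != 0 -> u != 0 -> (a *m u) 0 0 = 0 ->
  exists2 g, g \in Gs & (a *m (g *m v)) 0 0 = 0.
Proof.
move=> e v0 u0 au; have lu : line <[u]>%VS by apply/lineP; exists u.
have := line_orbit_refl lu; rewrite -e line_orbitE => -[g gG eg]; exists g => //.
have /vlineP[k ->] : g *m v \in <[u]>%VS by rewrite -eg memv_line.
by rewrite -scalemxAr mxE au mulr0.
Qed.

(** This provides a representative on the plane z = 0, one of the three planes used for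
    genericity. *)
Lemma pt9_conj0 : eorbit pt9 = orbit (- 1) 1 0.
Proof.
rewrite (@orbit_eis R (eopp eis1) eis1 eis0) ?evN ?ev1 ?ev0 //.
by apply/esym/orbit_conj => //; apply: (allP pt9_conj).
Qed.

Lemma generic216 (nu : C) : 9.-primitive_root nu ->
  is_generic (@orbit_closed R) line_orbits (line_orbits_of 216 0 0).
Proof.
move=> nu9; pose a1 : 'rV[C]_3 := (vec3 0 0 1)^T.
pose a2 : 'rV[C]_3 := (vec3 0 1 (- 1))^T; pose a3 : 'rV[C]_3 := (vec3 1 0 (- nu))^T.
have n0 (v : V) : v != 0 -> v^T != 0.
  by apply: contraNneq => e; rewrite -(trmxK v) e trmx0.
apply: (@generic_off_planes R [:: a1; a2; a3]) => //.
  by rewrite /= !n0 // vec3_eq0 ?oner_eq0 ?andbF.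
move=> v v0 off.
have no a (u : V) : a \in [:: a1; a2; a3] -> u != 0 -> (a *m u) 0 0 = 0 ->
    line_orbit <[v]>%VS = line_orbit <[u]>%VS -> False.
  move=> sa u0 au e; have [g gG] := off_line_orbit e v0 u0 au.
  by apply/eqP; exact: off.
have [m1 m2 m3] : [/\ a1 \in [:: a1; a2; a3], a2 \in [:: a1; a2; a3] &
    a3 \in [:: a1; a2; a3]] by rewrite !inE !eqxx !orbT.
have [//|e|t _ e|e|t _ e|e|e|e] := classification nu9 v0; exfalso.
- apply: no m3 _ _ e; first by rewrite vec3_eq0 oner_eq0 !andbF.
  by rewrite mul_row3; ring.
- by apply: no m2 (vec3_neq0 _ _) _ e; rewrite mul_row3; ring.
- by apply: no m2 (vec3_neq0 _ _) _ e; rewrite mul_row3; ring.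
- by apply: no m1 (vec3_neq0 _ _) _ e; rewrite mul_row3; ring.
- apply: no m2 _ _ e; first by rewrite -(vec0bE R).
  by rewrite mul_row3 /= ev0 ev1; ring.
- apply: no m1 _ _ e; first by rewrite -(vec0bE R).
  by rewrite mul_row3 /= ev0 ev1; ring.
- by rewrite pt9_conj0 in e; apply: no m1 (vec3_neq0 _ _) _ e; rewrite mul_row3; ring.
Qed.

Lemma finite_not_good roots quads : all (fun k => ~~ vec0b k) quads ->
  finite_set [set t : C | ~~ good roots quads t].
Proof.
move=> /allP q0; pose p (k : evec) : {poly C} := Poly [:: ev (e3 k); ev (e2 k); ev (e1 k)].
have pE k t : (p k).[t] = elin k (t ^+ 2) t 1.
  by rewrite horner_Poly /= !elinE; ring.
have pn0 k : k \in quads -> p k != 0.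
  move=> /q0; apply: contra => /eqP e.
  rewrite (vec0bE R) vec3_eq0; have c i : (p k)`_i = 0 by rewrite e coef0.
  have := c 0%N; have := c 1%N; have := c 2%N; rewrite !coef_Poly /=.
  by move=> -> -> ->; rewrite !eqxx.
suff : finite_set ([set` map ev roots] `|`
    \bigcup_(k in [set` quads]) [set t | (p k).[t] = 0]).
  apply: sub_finite_set => t; rewrite /= /good negb_and => /orP[]/allPn[k kr].
    by move=> /negPn/eqP ->; left; apply: map_f.
  by move=> /negPn/eqP e; right; exists k => //=; rewrite pE.
rewrite finite_setU; split; first exact: finite_seq.
by apply: bigcup_finite => [|k /pn0]; [exact: finite_seq | exact: finite_roots].
Qed.

Lemma pencil_vec3 (y z t : C) : vec3 t y z = vec3 0 y z + t *: vec3 1 0 0.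
Proof. by rewrite scale_vec3 add_vec3 !mulr0 !addr0 add0r mulr1. Qed.

Lemma pencil_family (z : C) (P : C -> bool) (S : set (set {vspace V})) :
  finite_set [set t | ~~ P t] -> S = [set orbit t 1 z | t in [set t | P t]] ->
  infinite_set S /\ has_dimension (@orbit_closed R) S 1.
Proof.
move=> fP ->; have -> : [set orbit t 1 z | t in [set t | P t]] =
    [set line_orbit <[(vec3 0 1 z + t *: vec3 1 0 0)%R]>%VS | t in [set t | P t]].
  by apply: eq_imagel => t _; rewrite -pencil_vec3.
have uv (t : C) : vec3 0 1 z + t *: vec3 1 0 0 != 0 by rewrite -pencil_vec3 vec3_neq0.
have inj : injective (fun t : C => <[(vec3 0 1 z + t *: vec3 1 0 0)%R]>%VS).
  move=> s t /eqP; rewrite -!pencil_vec3 eq_line ?vec3_neq0 // mem_line_vec3 ?vec3_neq0 //.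
  by move=> /and3P[_ _ /eqP]; rewrite !mulr1 mul1r.
by split; [exact: pencil_infinite | exact: pencil_dimension].
Qed.

Lemma orbits108 (nu : C) : 9.-primitive_root nu ->
  @line_orbits_of R 108 0 1 = [set orbit t 1 1 | t in [set t | good rootsE quadsE t]].
Proof.
move=> nu9; apply/seteqP; split => [O /(table_rowP nu9) h|_ [t gt <-]].
  by inversion h as [| |t gt e| | | | |]; exists t.
exact: type108.
Qed.

Lemma orbits72_1 (nu : C) : 9.-primitive_root nu ->
  @line_orbits_of R 72 1 0 = [set orbit t 1 0 | t in [set t | good rootsH quadsH t]].
Proof.
move=> nu9; apply/seteqP; split => [O /(table_rowP nu9) h|_ [t gt <-]].
  by inversion h as [| | | |t gt e| | |]; exists t.
exact: type72_1.
Qed.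

Lemma card_single (T : Type) (A : set T) x : A = [set x] -> (A #= `I_1)%card.
Proof. by move=> ->; exact: card_set1. Qed.

Lemma orbit_P54 : line_orbit (proj_pt (1 + sqrtC 3) w 1) = orbit (s3 R) 1 1.
Proof.
have o1 : eis1 \in eunits by rewrite inE.
have ow : eisw \in eunits by rewrite !inE.
have := orbit_diag (s3 R) 1 1 o1 ow o1.
by rewrite evw ev1 !mul1r mulr1 proj_ptE.
Qed.

End Table.

(* P54: the source's [0 : omega : 1] lies on the reflection plane x = 0 and has
   an orbit of size 36; its first coordinate is corrected here. *)
Theorem proposition5p3p3 (R : realType) (nu : R[i])
    (nu9 : 9.-primitive_root nu) :
  let P72 := proj_pt nu (nu ^+ 2) 1 in
  let P54 := proj_pt (1 + sqrtC 3) omega (1 : R[i]) in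
  (* the table is exhaustive *)
  (forall O : set {vspace 'cV[R[i]]_3}, line_orbits O ->
     line_orbits_of 216 0 0 O \/ line_orbits_of 72 0 0 O \/
     line_orbits_of 108 0 1 O \/ line_orbits_of 54 0 1 O \/
     line_orbits_of 72 1 0 O \/ line_orbits_of 36 1 1 O \/
     line_orbits_of 12 2 3 O \/ line_orbits_of 9 4 0 O) /\
  (* number of orbits of each kind *)
  is_generic (@orbit_closed R) line_orbits (line_orbits_of 216 0 0) /\
  (@line_orbits_of R 72 0 0 #= `I_1)%card /\
  (infinite_set (@line_orbits_of R 108 0 1) /\
   has_dimension orbit_closed (@line_orbits_of R 108 0 1) 1) /\
  (@line_orbits_of R 54 0 1 #= `I_1)%card /\
  (infinite_set (@line_orbits_of R 72 1 0) /\
   has_dimension orbit_closed (@line_orbits_of R 72 1 0) 1) /\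
  (@line_orbits_of R 36 1 1 #= `I_1)%card /\
  (@line_orbits_of R 12 2 3 #= `I_1)%card /\
  (@line_orbits_of R 9 4 0 #= `I_1)%card /\
  (* representatives *)
  [set O | [/\ line_orbits O, (O #= `I_72)%card &
              forall L, O L -> reflection_planes_through L = set0]]
    = [set line_orbit P72] /\
  [set O | line_orbits O /\ (O #= `I_54)%card] = [set line_orbit P54] /\
  (* away from these two orbits, the numbers of planes determine the size *)
  (forall L L', line L -> line L' ->
     ~ (line_orbit P72 `|` line_orbit P54) L ->
     ~ (line_orbit P72 `|` line_orbit P54) L' ->
     (reflection_planes_through L #= reflection_planes_through L')%card ->
     (proper_planes_through L #= proper_planes_through L')%card ->
     (line_orbit L #= line_orbit L')%card).
Proof.
move=> P72 P54; have eP54 := orbit_P54 R.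
have tP72 : line_orbits_of 72 0 0 (line_orbit P72) := type_P72 nu9.
have tP54 : line_orbits_of 54 0 1 (line_orbit P54).
  by rewrite eP54; apply: type54; exact: s3E.
split.
  move=> O /(table_complete nu9)[n [r [p [row h]]]].
  by case: row h => [|_|t _ _|_|t _ _|_|_|_]; tauto.
split; first exact: generic216 nu9.
split.
  apply: (@card_single _ _ (line_orbit P72)); apply/seteqP; split => [O|_ -> //].
  by move=> /(table_rowP nu9) h; inversion h.
split.
  apply: pencil_family (orbits108 nu9); exact: finite_not_good.
split.
  apply: (@card_single _ _ (line_orbit P54)); apply/seteqP; split => [O|_ -> //].
  by move=> /(table_rowP nu9) h; inversion h; rewrite /P54 eP54.
split.
  apply: pencil_family (orbits72_1 nu9); exact: finite_not_good.
split.
  apply: card_single; apply/seteqP; split => [O|_ ->]; last exact: type36.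
  by move=> /(table_rowP nu9) h; inversion h.
split.
  apply: card_single; apply/seteqP; split => [O|_ ->]; last exact: type12.
  by move=> /(table_rowP nu9) h; inversion h.
split.
  apply: card_single; apply/seteqP; split => [O|_ ->]; last exact: type9.
  by move=> /(table_rowP nu9) h; inversion h.
split.
  apply/seteqP; split => [O [Ol cO h]|_ ->].
    have [n [r [p [row [_ cO' hL]]]]] := table_complete nu9 Ol.
    have en := card_II_inj cO' cO.
    have [L OL] := line_orbits_nonempty Ol.
    have er : r = 0%N.
      by have [hr _] := hL L OL; apply: card_II_inj hr _; rewrite h // II0.
    by rewrite {}en {}er in row; inversion row.
  have [Ol cO h] := tP72; split => // L /h[+ _].
  by rewrite II0 card_eq0 => /eqP.
split.
  apply/seteqP; split => [O [Ol cO]|_ ->]; last by have [Ol cO _] := tP54.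
  have [n [r [p [row [_ cO' hL]]]]] := table_complete nu9 Ol.
  have en := card_II_inj cO' cO.
  by rewrite {}en in row; inversion row; rewrite /P54 eP54.
move=> L L' lL lL' nL nL' hr hp.
have ol (M : {vspace 'cV[R[i]]_3}) : line M -> line_orbits (line_orbit M) by move=> lM; exists M.
have [n [r [p [row [_ cO hO]]]]] := table_complete nu9 (ol _ lL).
have [n' [r' [p' [row' [_ cO' hO']]]]] := table_complete nu9 (ol _ lL').
have [hr1 hp1] := hO L (line_orbit_refl lL).
have [hr1' hp1'] := hO' L' (line_orbit_refl lL').
have er : r = r' := card_II_inj hr1 (card_eq_trans hr hr1').
have ep : p = p' := card_II_inj hp1 (card_eq_trans hp hp1').
suff en : n = n' by rewrite -en in cO'; exact: card_eq_trans cO (card_esym cO').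
have off (M : {vspace 'cV[R[i]]_3}) : line M -> ~ (line_orbit P72 `|` line_orbit P54) M ->
    line_orbit M <> line_orbit P72 /\ line_orbit M <> line_orbit P54.
  by move=> lM nM; split => e; apply: nM; [left | right]; rewrite -e; exact: line_orbit_refl.
have [n72 n54] := off L lL nL; have [n72' n54'] := off L' lL' nL'.
rewrite eP54 in n54 n54'.
(* Equal plane counts with different sizes occur only at (0, 0), for 216 and 72, and at (0, 1), for
   108 and 54; the two excluded orbits are those of sizes 72 and 54 in these pairs. *)
move: er ep; case: row => [|/n72[]|t _ _|/n54[]|t _ _|_|_|_];
  by case: row' => [|/n72'[]|t' _ _|/n54'[]|t' _ _|_|_|_].
Qed.
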